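(* Let $v=C+Q'$ be as in the context. Let $\mathcal{F}:L^2([0,\pi])\to\ell^2(\mathbb{N})$ be the Fourier isomorphism $f\mapsto(f_k)_{k\in\mathbb{N}}$, $f_k=(f,\sqrt2\sin kx)$. Let $\mathcal{L}_d$ be the operator in $\ell^2(\mathbb{N})$ defined by $$\mathcal{L}_d(z)=(h_k(z))_{k\in\mathbb{N}},\qquad h_k(z)=k^2z_k+\frac1{\sqrt2}\sum_{m\in\mathbb{N}}\big(\tilde V(|k-m|)-\tilde V(k+m)\big)z_m+Cz_k,$$ on the domain $D(\mathcal{L}_d)=\{z\in\ell^2(|k|,\mathbb{N}):\ \mathcal{L}_d(z)\in\ell^2(\mathbb{N})\}$, where $\ell^2(|k|,\mathbb{N})=\{z=(z_k)_{k\in\mathbb{N}}:\ \sum_k|k|^2|z_k|^2<\infty\}$. Then $D(L_{Dir})=\mathcal{F}^{-1}(D(\mathcal{L}_d))$ and $L_{Dir}=\mathcal{F}^{-1}\circ\mathcal{L}_d\circ\mathcal{F}$.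
   Context: $v\in H^{-1}_{loc}(\mathbb{R})$ is a $\pi$-periodic distribution written (uniquely) as $v=C+Q'$ with $C\in\mathbb{C}$ and $Q\in L^2_{loc}(\mathbb{R})$ $\pi$-periodic with $\int_0^\pi Q=0$. Inner product on $L^2([0,\pi])$: $(f,g)=\frac1\pi\int_0^\pi f\overline g$. $Q\sim\sum_{k\ge1}\tilde q(k)\sqrt2\sin kx$ is the sine expansion of $Q$ on $[0,\pi]$; $\tilde V(0)=0$, $\tilde V(k)=k\tilde q(k)$ for $k\in\mathbb{N}$. $\ell(y)=-(y'-Qy)'-Qy'+Cy$. $L_{Dir}$ is the operator $y\mapsto\ell(y)$ in $L^2([0,\pi])$ with domain $\{y\in H^1([0,\pi]): y'-Qy\in W^1_1([0,\pi]),\ y(0)=y(\pi)=0,\ \ell(y)\in L^2([0,\pi])\}$, $W^1_1$ denoting absolutely continuous functions. *)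

(* Defs.v *)
From mathcomp Require Import all_boot all_order all_algebra.
From mathcomp Require Import all_classical all_reals all_analysis.
From mathcomp.real_closed Require Import complex.
Set Implicit Arguments. Unset Strict Implicit. Unset Printing Implicit Defensive.
Import Order.TTheory GRing.Theory Num.Theory numFieldNormedType.Exports.
Local Open Scope classical_set_scope.
Local Open Scope ring_scope.
Local Open Scope complex_scope.

Section Defs.
Variable R : realType.

Notation mu := (@lebesgue_measure R).

Definition Icc (a b : R) : set R := `[a, b]%classic.

Definition cre (z : R[i]) : R := complex.Re z.
Definition cim (z : R[i]) : R := complex.Im z.
Definition csq (z : R[i]) : R := cre z ^+ 2 + cim z ^+ 2.

Definition cintegrable (D : set R) (f : R -> R[i]) : Prop :=
  mu.-integrable D (fun x => (cre (f x))%:E) /\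
  mu.-integrable D (fun x => (cim (f x))%:E).

Definition cL2 (D : set R) (f : R -> R[i]) : Prop :=
  measurable_fun D (fun x => cre (f x)) /\
  measurable_fun D (fun x => cim (f x)) /\
  mu.-integrable D (fun x => (csq (f x))%:E).

Definition cint (a b : R) (f : R -> R[i]) : R[i] :=
  (Rintegral mu (Icc a b) (fun x => cre (f x))) +i*
  (Rintegral mu (Icc a b) (fun x => cim (f x))).

Definition ae_eqc (D : set R) (f g : R -> R[i]) : Prop :=
  {ae mu, forall x, D x -> f x = g x}.

Definition rC (r : R) : R[i] := r +i* 0.

(** Fourier sine coefficient f_k = (f, sqrt2 sin kx), with
    (f,g) = (1/pi) int_0^pi f conj(g). *)
Definition fcoef (f : R -> R[i]) (k : nat) : R[i] :=
  rC (pi^-1) * cint 0 pi (fun x => f x * rC (Num.sqrt 2 * sin (k%:R * x))).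

Definition Vt (Q : R -> R[i]) (k : nat) : R[i] :=
  if k is 0 then 0 else rC k%:R * fcoef Q k.

Definition cseries_to (u : nat -> R[i]) (s : R[i]) : Prop :=
  (series (fun m => cre (u m)) @ \oo --> cre s) /\
  (series (fun m => cim (u m)) @ \oo --> cim s).

Definition rsum_finite (u : nat -> R) : Prop := cvg (series u @ \oo).

Definition in_l2k (z : nat -> R[i]) : Prop :=
  rsum_finite (fun k => (k.+1)%:R ^+ 2 * csq (z k.+1)).

Definition in_l2 (z : nat -> R[i]) : Prop :=
  rsum_finite (fun k => csq (z k.+1)).

Definition ndist (k m : nat) : nat := (k - m + (m - k))%N.

Definition Ld_rel (Q : R -> R[i]) (C : R[i]) (z h : nat -> R[i]) : Prop :=
  forall k : nat, (1 <= k)%N ->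
    exists s : R[i],
      cseries_to (fun m => (Vt Q (ndist k m.+1) - Vt Q (k + m.+1)) * z m.+1) s /\
      h k = rC (k%:R ^+ 2) * z k + rC ((Num.sqrt 2)^-1) * s + C * z k.

Definition in_dom_Ld (Q : R -> R[i]) (C : R[i]) (z : nat -> R[i]) : Prop :=
  in_l2k z /\ exists h, Ld_rel Q C z h /\ in_l2 h.

(** y in D(L_Dir) and L_Dir y = f (a.e. on [0,pi]).
    H^1 / W^1_1 on [0,pi] are expressed as: absolutely continuous
    = indefinite integral of an L^1 function. *)
Definition LDir_rel (Q : R -> R[i]) (C : R[i]) (y f : R -> R[i]) : Prop :=
  exists g w u : R -> R[i],
    (* y in H^1([0,pi]) with y' = g *)
    cL2 (Icc 0 pi) g /\
    (forall x, Icc 0 pi x -> y x = y 0 + cint 0 x g) /\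
    (* y' - Q y = w a.e., with w in W^1_1([0,pi]) and w' = u *)
    cintegrable (Icc 0 pi) u /\
    (forall x, Icc 0 pi x -> w x = w 0 + cint 0 x u) /\
    ae_eqc (Icc 0 pi) (fun x => g x - Q x * y x) w /\
    y 0 = 0 /\ y pi = 0 /\
    (* l(y) = -(y' - Q y)' - Q y' + C y  belongs to L^2 and equals f *)
    cL2 (Icc 0 pi) f /\
    ae_eqc (Icc 0 pi) f (fun x => - u x - Q x * g x + C * y x).

End Defs.

(* Main.v *)
(** Integrating by parts against [sin kx] turns [l(y) = f] into
    [f_k = k^2 y_k - (1/pi) int Q (y sqrt2 sin kx)' + C y_k].  Expanding [y] in
    sines and [y'] in cosines, Parseval's identity rewrites the middle term as
    the convolution sum with [Vt] that defines [Ld]; this gives one inclusion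
    of domains and the formula for the operator.  Conversely, if [z] is in the
    domain of [Ld], Riesz-Fischer produces [y'] from [k z_k] and [f] from
    [Ld z]; then [y' - Q y] and the primitive of [u = - f - Q y' + C y] have
    the same cosine coefficients of positive index, so they differ by a
    constant, which is the regularity of [y' - Q y] required of [D(L_Dir)].

    Completeness of the cosines is proved in [L^1]: a function orthogonal to
    all [cos kx] is orthogonal to every polynomial in [cos x], and polynomials
    in [cos x] converge boundedly to the indicator of [0, a], so its primitive
    vanishes. *)
Require Import Defs.
From mathcomp Require Import all_boot all_order all_algebra.
From mathcomp Require Import all_classical all_reals all_analysis.
From mathcomp.real_closed Require Import complex.
From mathcomp Require Import measurable_realfun ring lra.
Import Order.TTheory GRing.Theory Num.Theory numFieldNormedType.Exports.
Set Implicit Arguments. Unset Strict Implicit. Unset Printing Implicit Defensive.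
Local Open Scope classical_set_scope.
Local Open Scope ring_scope.

(** * Integrable and square-integrable functions *)

(** With [Q] only square-integrable, [Q y'] and hence the derivative [u] of the quasi-derivative
    [y' - Q y] are merely integrable. Derivatives are therefore always moved onto the smooth sine or
    cosine, and uniqueness is needed for integrable functions. The weights [|k-m|] and [k+m] in the
    matrix of [Ld] are unbounded, so its rows cannot be summed by bounding [Vt]. Writing the kernel
    through $(\sin kx \sin mx)'$ splits each row into two convergent Parseval sums: [Q sin kx]
    against [y'] in cosines, and [k Q cos kx] against [y] in sines. The Dirichlet conditions are
    carried by $y = \int_0^x F$ with $\int_0^\pi F = 0$; this removes the boundary terms and the
    constant mode of [y']. The integral of [Q y' sin kx] occurs both in the coefficient of [l(y)]
    and in the convolution sum. It cancels, so the coefficient identity is equivalent to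
    [(y' - Q y)' = u] tested against [sin kx], and one equivalence serves both inclusions. The
    bounded approximants of an indicator are the $(1-s^n)^{2^n}$ of the Brosowski-Deutsch proof of
    Stone-Weierstrass. All test functions are real, so the analysis is done for real functions and
    then applied to real and imaginary parts. *)

Section L1L2.
Context d (T : measurableType d) (R : realType).
Variables (mu : {measure set T -> \bar R}) (D : set T).
Hypothesis mD : measurable D.
Implicit Types (f g : T -> R) (c : R).

Definition in_L1 (f : T -> R) := mu.-integrable D (fun x => (f x)%:E).
Definition in_L2 (f : T -> R) :=
  measurable_fun D f /\ in_L1 (fun x => f x ^+ 2).

Local Notation J f := (Rintegral mu D f).

Lemma in_L1_measurable f : in_L1 f -> measurable_fun D f.
Proof. by move=> /(measurable_int mu)/measurable_EFinP. Qed.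

Lemma in_L1_eq f g : {in D, f =1 g} -> in_L1 f -> in_L1 g.
Proof.
by move=> fg; apply: eq_integrable => // x xD; rewrite fg.
Qed.

Lemma in_L1_le f g : measurable_fun D f -> (forall x, D x -> `|f x| <= g x) ->
  in_L1 g -> in_L1 f.
Proof.
move=> mf fg; apply: le_integrable => //; first exact/measurable_EFinP.
by move=> x Dx; rewrite /= lee_fin (le_trans (fg _ Dx)) // ler_norm.
Qed.

Lemma in_L1D f g : in_L1 f -> in_L1 g -> in_L1 (fun x => f x + g x).
Proof. exact: integrableD. Qed.

Lemma in_L1B f g : in_L1 f -> in_L1 g -> in_L1 (fun x => f x - g x).
Proof. exact: integrableB. Qed.

Lemma in_L1Z c f : in_L1 f -> in_L1 (fun x => c * f x).
Proof. exact: integrableZl. Qed.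

Lemma in_L1_sum (F : nat -> T -> R) n : (forall k, in_L1 (F k)) ->
  in_L1 (fun x => \sum_(0 <= k < n) F k x).
Proof.
move=> hF; elim: n => [|n ih].
  by apply: (@in_L1_eq (fun=> 0)) (integrable0 _ _) => x _; rewrite big_geq.
apply: in_L1_eq (in_L1D ih (hF n)) => x _.
by rewrite big_nat_recr.
Qed.

Lemma in_L1_bounded f g (M : R) : measurable_fun D g ->
  (forall x, D x -> `|g x| <= M) -> in_L1 f -> in_L1 (fun x => g x * f x).
Proof.
move=> mg gM fL; have M1 : in_L1 (fun x => M * `|f x|).
  by apply: in_L1Z; apply: integrable_norm.
apply: in_L1_le M1 => [|x Dx].
  by apply: measurable_funM => //; exact: in_L1_measurable.
by rewrite normrM ler_wpM2r // gM.
Qed.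

Lemma JD f g : in_L1 f -> in_L1 g -> J (fun x => f x + g x) = J f + J g.
Proof. exact: RintegralD. Qed.

Lemma JB f g : in_L1 f -> in_L1 g -> J (fun x => f x - g x) = J f - J g.
Proof. exact: RintegralB. Qed.

Lemma JZ c f : in_L1 f -> J (fun x => c * f x) = c * J f.
Proof. exact: RintegralZl. Qed.

Lemma eq_J f g : (forall x, D x -> f x = g x) -> J f = J g.
Proof. by move=> fg; apply: eq_Rintegral => x /set_mem /fg. Qed.

Lemma J_sum (F : nat -> T -> R) n : (forall k, in_L1 (F k)) ->
  J (fun x => \sum_(0 <= k < n) F k x) = \sum_(0 <= k < n) J (F k).
Proof.
move=> hF; elim: n => [|n ih].
  rewrite big_geq //.
  rewrite (@eq_J _ (fun=> 0 * 0)); last by move=> x _; rewrite big_geq // mul0r.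
  by rewrite JZ ?mul0r //; exact: integrable0.
rewrite big_nat_recr //= -ih -JD //; last exact: in_L1_sum.
by apply: eq_J => x _; rewrite big_nat_recr.
Qed.

Lemma ae_eq_J f g : measurable_fun D f -> measurable_fun D g ->
  {ae mu, forall x, D x -> f x = g x} -> J f = J g.
Proof.
move=> mf mg fg; rewrite /Rintegral; congr fine; apply: ae_eq_integral => //.
- exact/measurable_EFinP.
- exact/measurable_EFinP.
- by apply: filterS fg => x h Dx; rewrite h.
Qed.

Lemma in_L2_measurable f : in_L2 f -> measurable_fun D f.
Proof. by case. Qed.

Lemma in_L2M f g : in_L2 f -> in_L2 g -> in_L1 (fun x => f x * g x).
Proof.
move=> [mf f2] [mg g2]; apply: in_L1_le (in_L1D f2 g2) => [|x _].
  exact: measurable_funM.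
have := (sqr_ge0 (f x + g x), sqr_ge0 (f x - g x), sqr_ge0 (f x), sqr_ge0 (g x)).
by case=> -[[]]; rewrite ler_norml !expr2 => *; apply/andP; split; lra.
Qed.

Lemma in_L2D f g : in_L2 f -> in_L2 g -> in_L2 (fun x => f x + g x).
Proof.
move=> [mf f2] [mg g2]; split; first exact: measurable_funD.
apply: in_L1_le (in_L1Z 2 (in_L1D f2 g2)) => [|x _].
  by apply: measurable_funX; exact: measurable_funD.
by rewrite ger0_norm ?sqr_ge0 //; have := sqr_ge0 (f x - g x); rewrite !expr2; lra.
Qed.

Lemma in_L2Z c f : in_L2 f -> in_L2 (fun x => c * f x).
Proof.
move=> [mf f2]; split; first exact: measurable_funM.
by apply: in_L1_eq (in_L1Z (c ^+ 2) f2) => x _; rewrite exprMn.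
Qed.

Lemma in_L2B f g : in_L2 f -> in_L2 g -> in_L2 (fun x => f x - g x).
Proof.
move=> fL gL; rewrite (_ : (fun _ => _) = (fun x => f x + (-1) * g x)).
  by apply: in_L2D => //; exact: in_L2Z.
by apply/funext => x; rewrite mulN1r.
Qed.

Lemma in_L2_0 : in_L2 (fun=> 0).
Proof.
split; first exact: measurable_cst.
by apply: (@in_L1_eq (fun=> 0)) (integrable0 _ _) => x _; rewrite expr0n.
Qed.

Lemma in_L2_sum (F : nat -> T -> R) n : (forall k, in_L2 (F k)) ->
  in_L2 (fun x => \sum_(0 <= k < n) F k x).
Proof.
move=> hF; elim: n => [|n ih].
  rewrite (_ : (fun _ => _) = fun=> 0); first exact: in_L2_0.
  by apply/funext => x; rewrite big_geq.
rewrite (_ : (fun _ => _) = fun x => \sum_(0 <= k < n) F k x + F n x).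
  exact: in_L2D.
by apply/funext => x; rewrite big_nat_recr.
Qed.

Lemma in_L2_bounded f g (M : R) : measurable_fun D g ->
  (forall x, D x -> `|g x| <= M) -> in_L2 f -> in_L2 (fun x => g x * f x).
Proof.
move=> mg gM [mf f2]; split; first exact: measurable_funM.
apply: (@in_L1_eq (fun x => g x ^+ 2 * f x ^+ 2)).
  by move=> x _; rewrite exprMn.
apply: (@in_L1_bounded _ _ (M ^+ 2)) => [|x Dx|//].
  exact: measurable_funX.
by rewrite normrX lerXn2r ?nnegrE ?gM // (le_trans _ (gM _ Dx)).
Qed.

Lemma J_ge0 f : (forall x, D x -> 0 <= f x) -> 0 <= J f.
Proof. exact: Rintegral_ge0. Qed.

Lemma J_sqr_ge0 f : 0 <= J (fun x => f x ^+ 2).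
Proof. by apply: J_ge0 => x _; exact: sqr_ge0. Qed.

Lemma le_J f g : in_L1 f -> in_L1 g -> (forall x, D x -> f x <= g x) ->
  J f <= J g.
Proof. by move=> fL gL fg; apply: le_Rintegral. Qed.

Lemma Cauchy_Schwarz f g : in_L2 f -> in_L2 g ->
  J (fun x => f x * g x) ^+ 2 <= J (fun x => f x ^+ 2) * J (fun x => g x ^+ 2).
Proof.
move=> fL gL.
have fg := in_L2M fL gL.
(* A quadratic form in two variables: well-chosen pairs replace a division by the integral of
   [f ^+ 2], which may vanish. *)
have H (t s : R) : 0 <= t ^+ 2 * J (fun x => f x ^+ 2) +
    2 * t * s * J (fun x => f x * g x) + s ^+ 2 * J (fun x => g x ^+ 2).
  have := J_sqr_ge0 (fun x => t * f x + s * g x).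
  have f2 := fL.2; have g2 := gL.2.
  have e : (fun x => (t * f x + s * g x) ^+ 2) =
      (fun x => t ^+ 2 * f x ^+ 2 + 2 * t * s * (f x * g x) + s ^+ 2 * g x ^+ 2).
    by apply/funext => x; ring.
  rewrite e JD ?JD ?JZ //; do ?[exact: in_L1Z].
  by apply: in_L1D; exact: in_L1Z.
have a0 := J_sqr_ge0 f; have c0 := J_sqr_ge0 g.
move: H a0 c0; set a := J _; set b := J _; set c := J _ => H a0 c0.
have [a_gt0|] := ltP 0 a.
  (* At the pair $(-b, a)$ the form equals $a(ac - b^2)$. *)
  have := H (- b) a => h; rewrite -subr_ge0 -(pmulr_rge0 _ a_gt0); nra.
move=> a_le0; have {a_le0}a00 : a = 0 by lra.
(* With $a = 0$ the form equals $-4b^4$ at this pair and $-(c+2)b^2$ at the next one; nonnegativity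
   forces $b = 0$. *)
have := H (- (c + 1) * b) (2 * b ^+ 2 + 0).
have := H (- (c + 1)) b; rewrite a00; nra.
Qed.

Hypothesis muD : (mu D < +oo)%E.

Lemma in_L1_cst c : in_L1 (fun=> c).
Proof.
apply: measurable_bounded_integrable => //.
exists `|c|; split; first exact: num_real.
by move=> M cM x _ /=; rewrite (le_trans _ (ltW cM)).
Qed.

Lemma in_L2_cst c : in_L2 (fun=> c).
Proof. by split; [exact: measurable_cst | exact: in_L1_cst]. Qed.

Lemma in_L2_L1 f : in_L2 f -> in_L1 f.
Proof.
move=> fL; apply: in_L1_eq (in_L2M (in_L2_cst 1) fL) => x _.
by rewrite mul1r.
Qed.

Lemma in_L2_of_bounded f (M : R) : measurable_fun D f ->
  (forall x, D x -> `|f x| <= M) -> in_L2 f.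
Proof.
move=> mf fM; have : in_L2 (fun x => f x * 1).
  by apply: (@in_L2_bounded (fun=> 1) f M) => //; exact: in_L2_cst.
by congr in_L2; apply/funext => x; rewrite mulr1.
Qed.

End L1L2.

(** * Orthogonal systems in L2 *)

Section OrthogonalSystem.
Context d (T : measurableType d) (R : realType).
Variables (mu : {measure set T -> \bar R}) (D : set T).
Hypotheses (mD : measurable D) (muD : (mu D < +oo)%E).
Variables (e : nat -> T -> R) (K : R).
Hypothesis K_gt0 : 0 < K.
Hypothesis e_L2 : forall k, in_L2 mu D (e k).

Local Notation J f := (Rintegral mu D f).
Local Notation in_L2 := (in_L2 mu D).
Local Notation in_L1 := (in_L1 mu D).

Hypothesis e_orth : forall j k, J (fun x => e j x * e k x) = K * (j == k)%:R.

Implicit Types (f g : T -> R) (c : nat -> R).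

(** [K] is the common squared norm of the system. Both systems below have [K = pi], so that
    [K^-1 * J] is the normalised inner product of the statement. *)
Definition coef f k := K^-1 * J (fun x => f x * e k x).
Definition partial_sum c n x := \sum_(0 <= k < n) c k * e k x.

Lemma psum_L2 c n : in_L2 (partial_sum c n).
Proof. by apply: in_L2_sum => // k; exact: in_L2Z. Qed.

Lemma J_psum f c n : in_L2 f ->
  J (fun x => f x * partial_sum c n x) = K * \sum_(0 <= k < n) c k * coef f k.
Proof.
move=> fL.
rewrite (_ : (fun _ => _) =
    (fun x => \sum_(0 <= k < n) c k * (f x * e k x))); last first.
  by apply/funext => x; rewrite mulr_sumr; apply: eq_bigr => k _; ring.
rewrite J_sum //; last by move=> k; apply: in_L1Z => //; exact: in_L2M.
rewrite mulr_sumr; apply: eq_bigr => k _.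
rewrite JZ //; last exact: in_L2M.
by rewrite /coef; field; rewrite gt_eqF.
Qed.

Lemma coef_psum c n k : (k < n)%N -> coef (partial_sum c n) k = c k.
Proof.
move=> kn; rewrite /coef.
rewrite (_ : (fun _ => _) = (fun x => e k x * partial_sum c n x)); last first.
  by apply/funext => x; rewrite mulrC.
rewrite J_psum // mulKf ?gt_eqF //.
rewrite (bigD1_seq k) ?iota_uniq ?mem_index_iota //= big1_seq ?addr0.
  by rewrite /coef e_orth eqxx mulr1 mulVf ?gt_eqF // mulr1.
by move=> j /andP[jk _]; rewrite /coef e_orth eq_sym (negbTE jk) !mulr0.
Qed.

Lemma J_psum_sqr c n :
  J (fun x => partial_sum c n x ^+ 2) = K * \sum_(0 <= k < n) c k ^+ 2.
Proof.
rewrite (_ : (fun _ => _) = (fun x => partial_sum c n x * partial_sum c n x)); last first.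
  by apply/funext => x; rewrite expr2.
rewrite J_psum; last exact: psum_L2.
by congr (_ * _); apply: eq_big_nat => k /andP[_ kn]; rewrite coef_psum // expr2.
Qed.

(** Kept for arbitrary [c]: the choice [c = coef f] yields Bessel's inequality, and taking a longer
    partial sum for [f] yields the Cauchy estimate. *)
Lemma J_dist_psum f c n : in_L2 f ->
  J (fun x => (f x - partial_sum c n x) ^+ 2) = J (fun x => f x ^+ 2) -
   K * (2 * \sum_(0 <= k < n) c k * coef f k - \sum_(0 <= k < n) c k ^+ 2).
Proof.
move=> fL; have sL := psum_L2 c n.
have fs := in_L2M mD fL sL; have f2 := fL.2; have s2 := sL.2.
rewrite (_ : (fun _ => _) = (fun x => f x ^+ 2 + (-2) * (f x * partial_sum c n x) +
  partial_sum c n x ^+ 2)); last by apply/funext => x; ring.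
rewrite JD ?JD ?JZ ?(J_psum _ _ fL) ?J_psum_sqr //; first ring.
- exact: in_L1Z.
- by apply: in_L1D => //; exact: in_L1Z.
Qed.

Lemma J_dist_coef f n : in_L2 f ->
  J (fun x => (f x - partial_sum (coef f) n x) ^+ 2) =
  J (fun x => f x ^+ 2) - K * series (fun k => coef f k ^+ 2) n.
Proof.
move=> fL; rewrite J_dist_psum // seriesEnat.
under [X in 2 * X]eq_bigr do rewrite -expr2.
by rewrite [in RHS]/=; ring.
Qed.

Lemma bessel f n : in_L2 f ->
  K * series (fun k => coef f k ^+ 2) n <= J (fun x => f x ^+ 2).
Proof.
by move=> fL; rewrite -subr_ge0 -J_dist_coef //; exact: J_sqr_ge0.
Qed.

Lemma series_sqr_nd c : nondecreasing_seq (series (fun k => c k ^+ 2)).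
Proof.
by apply: nondecreasing_series => k _ _; exact: sqr_ge0.
Qed.

Lemma bessel_cvg f : in_L2 f -> cvgn (series (fun k => coef f k ^+ 2)).
Proof.
move=> fL; apply: nondecreasing_is_cvgn.
  exact: series_sqr_nd.
exists (K^-1 * J (fun x => f x ^+ 2)) => _ [n _ <-].
by rewrite -ler_pdivrMl ?invr_gt0 // invrK bessel.
Qed.

Lemma J_psumB c m n : (m <= n)%N ->
  J (fun x => (partial_sum c n x - partial_sum c m x) ^+ 2) =
  K * (series (fun k => c k ^+ 2) n - series (fun k => c k ^+ 2) m).
Proof.
move=> mn; rewrite J_dist_psum; last exact: psum_L2.
rewrite J_psum_sqr !seriesEnat /=.
under [X in 2 * X]eq_big_nat => k /andP[_ km].
  rewrite coef_psum ?(leq_trans km) // -expr2; over.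
by rewrite /=; ring.
Qed.

Lemma J_psumB_norm c m n :
  J (fun x => (partial_sum c n x - partial_sum c m x) ^+ 2) =
  K * `|series (fun k => c k ^+ 2) n - series (fun k => c k ^+ 2) m|.
Proof.
case: (leqP m n) => [mn|/ltnW nm].
  by rewrite J_psumB // ger0_norm // subr_ge0; exact: series_sqr_nd.
rewrite distrC ger0_norm; last by rewrite subr_ge0; exact: series_sqr_nd.
by rewrite -J_psumB //; apply: eq_J => x _; rewrite -sqrrN opprB.
Qed.

(** * The Riesz-Fischer theorem *)

Lemma cvg0_of_sqr_le (a b : R^nat) : (\forall n \near \oo, a n ^+ 2 <= b n) ->
  b @ \oo --> 0 -> a @ \oo --> 0.
Proof.
move=> ab b0; apply/cvgrPdist_le => eps eps0.
have e2 : 0 < eps ^+ 2 by rewrite exprn_gt0.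
move/cvgrPdist_le : b0 => /(_ _ e2) h; near=> n.
rewrite sub0r normrN -ler_sqr ?nnegrE ?(ltW eps0) // real_normK ?num_real //.
apply: (@le_trans _ _ (b n)); first by near: n.
by apply: le_trans (ler_norm _) _; rewrite -normrN -sub0r; near: n.
Unshelve. all: end_near. Qed.

(** Weighted Young inequality. With [t = 2 ^+ j] on a set of finite measure it converts an [L^2]
    bound of squared size $4^{-j}$ into an [L^1] bound of order $2^{-j}$, without square roots. *)
Lemma norm_le_weighted_sqr (a t : R) : 0 < t -> `|a| <= t * a ^+ 2 + t^-1.
Proof.
move=> t0; have ti0 : 0 < t^-1 by rewrite invr_gt0.
have -> : t * a ^+ 2 + t^-1 = t^-1 * ((t * a) ^+ 2 + 1) by field; rewrite gt_eqF.
rewrite -(ler_pM2l t0) mulVKf ?gt_eqF // -{1}(gtr0_norm t0) -normrM.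
by rewrite -[(t * a) ^+ 2]real_normK ?num_real //; have := normr_ge0 (t * a); nra.
Qed.

(* Along a fast subsequence the increments are summable in [L^1], hence almost
   everywhere. *)
Lemma psum_subseq_cvg c (N : nat -> nat) :
  (forall j, K * `|series (fun k => c k ^+ 2) (N j.+1) -
                   series (fun k => c k ^+ 2) (N j)| <= (2 ^+ j)^-1 ^+ 2) ->
  {ae mu, forall x, D x -> cvgn (fun j => partial_sum c (N j) x)}.
Proof.
move=> hN; pose h j x := partial_sum c (N j.+1) x - partial_sum c (N j) x.
have hL2 j : in_L2 (h j) by apply: in_L2B => //; exact: psum_L2.
have hL1 j : in_L1 (fun x => `|h j x|).
  by apply: integrable_norm => //; exact: in_L2_L1.
(* The 1 comes from $2^j \cdot 4^{-j}$ and the measure of [D] from the constant $2^{-j}$ in the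
   weighted inequality at $t = 2^j$. *)
set B := 1 + fine (mu D).
have hB j : J (fun x => `|h j x|) <= B / 2 ^+ j.
  have t0 : 0 < 2 ^+ j :> R by rewrite exprn_gt0.
  have b1 : in_L1 (fun x => 2 ^+ j * h j x ^+ 2).
    by apply: in_L1Z => //; have [] := hL2 j.
  have b2 : in_L1 (fun x => (2 ^+ j)^-1 * 1).
    by apply: in_L1Z => //; exact: in_L1_cst.
  apply: (@le_trans _ _ (J (fun x => 2 ^+ j * h j x ^+ 2 + (2 ^+ j)^-1 * 1))).
    apply: le_J => // [|x _]; first exact: in_L1D.
    by rewrite mulr1; exact: norm_le_weighted_sqr.
  rewrite JD // JZ ?JZ //; [|exact: in_L1_cst|by have [] := hL2 j].
  rewrite Rintegral_cst // J_psumB_norm mul1r /B mulrDl mul1r.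
  rewrite [fine _ / _]mulrC lerD2r.
  apply: (le_trans (ler_wpM2l (ltW t0) (hN j))).
  by rewrite expr2 mulrA mulfV ?gt_eqF // mul1r.
have B0 : 0 <= B by rewrite addr_ge0 // fine_ge0.
have mh j : measurable_fun D (fun x => `|h j x|%:E).
  by apply/measurable_EFinP; exact: in_L1_measurable (hL1 j).
have Gfin : mu.-integrable D
    (fun x => (\sum_(0 <= j <oo) `|h j x|%:E)%E).
  apply/integrableP; split.
    by apply: ge0_emeasurable_sum.
  under eq_integral => x _.
    rewrite gee0_abs; last by apply: nneseries_ge0.
    over.
  rewrite integral_nneseries //.
  have -> : (\sum_(0 <= j <oo) \int[mu]_(x in D) `|h j x|%:E)%E =
      (\sum_(0 <= j <oo) (J (fun x => `|h j x|))%:E)%E.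
    by apply: eq_eseriesr => j _; rewrite /Rintegral fineK // integrable_fin_num //; exact: hL1.
  apply: (@le_lt_trans _ _ (\sum_(0 <= j <oo) (2 * B / (2 ^ (j + 1))%:R)%:E)%E).
    apply: lee_nneseries => [j _|j _].
      by rewrite lee_fin J_ge0.
    rewrite lee_fin (le_trans (hB j)) // addn1 expnS natrM invfM mulrACA.
    by rewrite mulfV // mul1r natrX.
  have := @cvg_geometric_eseries_half R (2 * B) 0.
  by move=> /cvg_lim; rewrite /eseries => -> //; exact: ltry.
(* Where the sum of the [|h j x|] is finite, the telescoping series of the increments converges
   absolutely. *)
apply: filterS (integrable_ae mD Gfin) => x hx Dx.
have /nnseries_is_cvg : forall j, 0 <= `|h j x| by [].
rewrite ltey_eq hx // => /(_ isT) /(@normed_cvg _ R^o (h ^~ x)).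
rewrite (_ : h ^~ x = telescope (fun j => partial_sum c (N j) x)) // telescopeK => hc.
have -> : (fun j => partial_sum c (N j) x) =
    (fun j => (partial_sum c (N j) x - partial_sum c (N 0%N) x) + partial_sum c (N 0%N) x).
  by apply/funext => j; rewrite subrK.
by apply: is_cvgD hc _; exact: is_cvg_cst.
Qed.

Lemma measurable_fun_limn_einf (g : (T -> \bar R)^nat) :
  (forall n, measurable_fun D (g n)) ->
  measurable_fun D (fun x => limn_einf (g ^~ x)).
Proof.
move=> mg; rewrite (_ : (fun _ => _) =
    (fun x => (- limn_esup ((fun n y => - g n y) ^~ x))%E)).
  apply: measurableT_comp => //; apply: measurable_fun_limn_esup => n.
  exact: measurableT_comp.
by apply/funext => x; rewrite -[in RHS]limn_einfN; congr limn_einf;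
  apply/funext => n /=; rewrite oppeK.
Qed.

(** The candidate is the pointwise limit along a fast subsequence; Fatou's lemma along that
    subsequence then bounds the distance to every partial sum by the tail of the coefficients. *)
Lemma riesz_fischer_dist c : cvgn (series (fun k => c k ^+ 2)) ->
  exists2 f, in_L2 f & forall n, J (fun x => (f x - partial_sum c n x) ^+ 2) <=
    K * (limn (series (fun k => c k ^+ 2)) - series (fun k => c k ^+ 2) n).
Proof.
set s := series _ => cs; set L := limn s.
have sL n : s n <= L.
  by apply: nondecreasing_cvgn_le => //; exact: series_sqr_nd.
(* [N] need not be increasing. This is why [s (N j)] is squeezed to [L] explicitly, and why
   increments are bounded by cases on the order of [s (N j)] and [s (N j.+1)]. *)
have /choice[N hN] : forall j, exists n, K * (L - s n) <= (2 ^+ j)^-1 ^+ 2.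
  move=> j; have t0 : 0 < (2 ^+ j)^-1 ^+ 2 / K :> R.
    by rewrite divr_gt0 // exprn_gt0 // invr_gt0 exprn_gt0.
  have /cvgrPdist_le/(_ _ t0)[n _ /(_ n (leqnn n))] := cs.
  rewrite ger0_norm ?subr_ge0 // => h; exists n.
  by rewrite mulrC -ler_pdivlMr.
have sN : s (N j) @[j --> \oo] --> L.
  have h0 : (fun j => (2 ^+ j)^-1 : R) @ \oo --> 0.
    rewrite (_ : (fun _ => _) = geometric 1 (2^-1)).
      by apply: cvg_geometric; rewrite ger0_norm ?invr_ge0 // invf_lt1 // ltr1n.
    by apply/funext => j /=; rewrite mul1r exprVn.
  apply: (@squeeze_cvgr _ _ _ _ (fun j => L - K^-1 * ((2 ^+ j)^-1 * (2 ^+ j)^-1)) (fun=> L)).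
  - near=> j; rewrite sL andbT -expr2 lerBlDl -lerBlDr -(ler_pM2l K_gt0).
    by rewrite mulVKf ?gt_eqF.
  - rewrite [X in _ --> X](_ : L = L - K^-1 * (0 * 0)); last by rewrite !mulr0 subr0.
    by apply: cvgB; [exact: cvg_cst|apply: cvgM; [exact: cvg_cst|exact: cvgM]].
  - exact: cvg_cst.
have ae_cvg : {ae mu, forall x, D x -> cvgn (fun j => partial_sum c (N j) x)}.
  apply: psum_subseq_cvg => j.
  have hj : (2 ^+ j.+1)^-1 ^+ 2 <= (2 ^+ j)^-1 ^+ 2 :> R.
    rewrite !exprVn lef_pV2 ?posrE ?exprn_gt0 // lerXn2r ?nnegrE ?exprn_ge0 //.
    by rewrite ler_eXn2l // ltr1n.
  have [le|/ltW le] := lerP (s (N j)) (s (N j.+1)).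
    by apply: le_trans (hN j); rewrite ler_pM2l // lerB.
  apply: le_trans hj; apply: le_trans (hN j.+1).
  by rewrite ler_pM2l // lerB.
(* The upper limit is measurable without any convergence assumption; it is the ordinary limit almost
   everywhere, and [fine] gives 0 where it is infinite. *)
pose f x := fine (limn_esup (fun j => (partial_sum c (N j) x)%:E)).
have mS n : measurable_fun D (partial_sum c n) by have [] := psum_L2 c n.
have mf : measurable_fun D f.
  apply: measurableT_comp; first exact: fine_measurable.
  by apply: measurable_fun_limn_esup => j; apply/measurable_EFinP.
have f_lim : {ae mu, forall x, D x -> partial_sum c (N j) x @[j --> \oo] --> f x}.
  apply: filterS ae_cvg => x hx Dx; have cx := hx Dx.
  have h : (partial_sum c (N j) x)%:E @[j --> \oo] -->
      (limn (fun j => partial_sum c (N j) x))%:E by apply/cvg_EFin => //; near=> j.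
  by rewrite /f; have [_ ->] := cvg_limn_einf_sup h.
(* Stated in the extended reals because integrability of this square is not yet known; it is deduced
   from this very bound. *)
have key n : (\int[mu]_(x in D) ((f x - partial_sum c n x) ^+ 2)%:E <=
    (K * (L - s n))%:E)%E.
  pose g j x := ((partial_sum c (N j) x - partial_sum c n x) ^+ 2)%:E.
  have mg j : measurable_fun D (g j).
    by apply/measurable_EFinP; apply: measurable_funX; exact: measurable_funB.
  rewrite (@ae_eq_integral _ _ _ _ _ (fun x => limn_einf (g ^~ x))) //.
  - apply: (le_trans (fatou mu mD mg _)) => [j x _|].
      by rewrite lee_fin sqr_ge0.
    have h : (K * `|s (N j) - s n|)%:E @[j --> \oo] --> (K * (L - s n))%:E.
      apply/cvg_EFin; first by near=> j.
      rewrite -[X in _ --> K * X]ger0_norm ?subr_ge0 //.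
      apply: cvgM; first exact: cvg_cst.
      by apply: cvg_norm; apply: cvgB => //; exact: cvg_cst.
    rewrite [X in limn_einf X](_ : _ = (fun j => (K * `|s (N j) - s n|)%:E)).
      by have [-> _] := cvg_limn_einf_sup h.
    apply/funext => j; rewrite -J_psumB_norm /Rintegral fineK //.
    apply: integrable_fin_num => //.
    by have [] := in_L2B mD (psum_L2 c (N j)) (psum_L2 c n).
  - by apply/measurable_EFinP; apply: measurable_funX; exact: measurable_funB.
  - exact: measurable_fun_limn_einf.
  - apply: filterS f_lim => x hx Dx.
    have h : g j x @[j --> \oo] --> ((f x - partial_sum c n x) ^+ 2)%:E.
      apply/cvg_EFin; first by near=> j.
      rewrite expr2 (_ : _ \o _ = (fun j => (partial_sum c (N j) x - partial_sum c n x) *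
        (partial_sum c (N j) x - partial_sum c n x))) //.
      by apply: cvgM; apply: cvgB; (try exact: cvg_cst); exact: hx.
    by have [-> _] := cvg_limn_einf_sup h.
have dL2 n : in_L2 (fun x => f x - partial_sum c n x).
  split; first exact: measurable_funB.
  apply/integrableP; split.
    by apply/measurable_EFinP; apply: measurable_funX; exact: measurable_funB.
  apply: le_lt_trans (ltry (K * (L - s n))); apply: le_trans (key n).
  apply: ge0_le_integral => //.
  - apply: measurableT_comp => //; apply/measurable_EFinP.
    by apply: measurable_funX; exact: measurable_funB.
  - apply/measurable_EFinP.
    by apply: measurable_funX; exact: measurable_funB.
  - by move=> x _; rewrite gee0_abs // lee_fin sqr_ge0.
exists f => [|n].
  rewrite (_ : f = (fun x => f x - partial_sum c 0 x)) //.
  by apply/funext => x; rewrite /partial_sum big_geq // subr0.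
rewrite -lee_fin /Rintegral fineK //; apply: integrable_fin_num => //.
by have [] := dL2 n.
Unshelve. all: end_near. Qed.

(** By Cauchy-Schwarz each coefficient is continuous for the [L^2] distance, and the [k]-th
    coefficient of the partial sums is [c k] as soon as [k < n]. *)
Lemma riesz_fischer c : cvgn (series (fun k => c k ^+ 2)) ->
  exists f, [/\ in_L2 f,
    J (fun x => (f x - partial_sum c n x) ^+ 2) @[n --> \oo] --> 0 &
    coef f = c].
Proof.
move=> cs; have [f fL hf] := riesz_fischer_dist cs.
have f0 : J (fun x => (f x - partial_sum c n x) ^+ 2) @[n --> \oo] --> 0.
  apply: (squeeze_cvgr _ (cvg_cst 0)); first last.
    rewrite (_ : 0 = K * (limn (series (fun k => c k ^+ 2)) -
                          limn (series (fun k => c k ^+ 2)))); last first.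
      by rewrite subrr mulr0.
    by apply: cvgM; [exact: cvg_cst|apply: cvgB cs; exact: cvg_cst].
  by near=> n; rewrite J_sqr_ge0 hf.
exists f; split => //; apply/funext => k.
have ek := e_L2 k.
(* A constant sequence tending to 0 is 0, which turns the limit argument into an equality. *)
suff h : (fun=> coef f k - c k) @ \oo --> (0 : R).
  apply/eqP; rewrite -subr_eq0; apply/eqP.
  exact: (cvg_unique _ (cvg_cst _) h).
have b0 : K^-1 ^+ 2 * (J (fun x => (f x - partial_sum c n x) ^+ 2) *
   J (fun x => e k x ^+ 2)) @[n --> \oo] --> 0.
  rewrite [X in _ --> X](_ : 0 = K^-1 ^+ 2 * (0 * J (fun x => e k x ^+ 2))).
    by apply: cvgM; [exact: cvg_cst|apply: cvgM => //; exact: cvg_cst].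
  by rewrite mul0r mulr0.
apply: cvg0_of_sqr_le b0; near=> n.
have kn : (k < n)%N by near: n; exact: nbhs_infty_gt.
rewrite -[X in coef f k - X](@coef_psum c n k) // /coef -mulrBr exprMn.
rewrite ler_wpM2l ?sqr_ge0 //.
have sL := psum_L2 c n.
rewrite -JB //; try exact: in_L2M.
rewrite (_ : (fun _ => _) = (fun x => (f x - partial_sum c n x) * e k x)).
  by apply: Cauchy_Schwarz => //; exact: in_L2B.
by apply/funext => x; rewrite mulrBl.
Unshelve. all: end_near. Qed.

(** * Consequences of completeness: expansion and Parseval's identity *)

Hypothesis e_complete : forall f, in_L2 f -> (forall k, coef f k = 0) ->
  {ae mu, forall x, D x -> f x = 0}.

Lemma coefB f g k : in_L2 f -> in_L2 g ->
  coef (fun x => f x - g x) k = coef f k - coef g k.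
Proof.
move=> fL gL; have ek := e_L2 k; rewrite /coef -mulrBr -JB //; try exact: in_L2M.
by congr (_ * _); apply: eq_J => x _; rewrite mulrBl.
Qed.

Lemma coef_inj f g : in_L2 f -> in_L2 g -> coef f = coef g ->
  {ae mu, forall x, D x -> f x = g x}.
Proof.
move=> fL gL fg; have h k : coef (fun x => f x - g x) k = 0.
  by rewrite coefB // fg subrr.
apply: filterS (e_complete (in_L2B mD fL gL) h) => x hx Dx.
by apply/eqP; rewrite -subr_eq0 hx.
Qed.

(** Riesz-Fischer supplies some [g] with the coefficients of [f] that is the limit of its own
    expansion; completeness identifies [g] with [f] almost everywhere. *)
Lemma expansion f : in_L2 f ->
  J (fun x => (f x - partial_sum (coef f) n x) ^+ 2) @[n --> \oo] --> 0.
Proof.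
move=> fL; have [g [gL g0 gc]] := riesz_fischer (bessel_cvg fL).
have fg := coef_inj gL fL gc.
rewrite (_ : (fun _ => _) =
  (fun n => J (fun x => (g x - partial_sum (coef f) n x) ^+ 2))) //.
apply/funext => n; have sL := psum_L2 (coef f) n.
apply: (@ae_eq_J _ _ _ mu _ mD).
- by apply: measurable_funX; apply: measurable_funB;
    exact: (in_L2_measurable (mu := mu)).
- by apply: measurable_funX; apply: measurable_funB;
    exact: (in_L2_measurable (mu := mu)).
- by apply: filterS fg => x hx Dx; rewrite hx.
Qed.

(** Only [g] is expanded: the error is [- K^-1] times the integral of [f] against the remainder of
    [g], controlled by Cauchy-Schwarz. *)
Lemma parseval f g : in_L2 f -> in_L2 g ->
  series (fun k => coef f k * coef g k) @ \oo -->
  K^-1 * J (fun x => f x * g x).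
Proof.
move=> fL gL; apply/subr_cvg0.
have b0 : K^-1 ^+ 2 * (J (fun x => f x ^+ 2) *
    J (fun x => (g x - partial_sum (coef g) n x) ^+ 2)) @[n --> \oo] --> 0.
  rewrite [X in _ --> X](_ : 0 = K^-1 ^+ 2 * (J (fun x => f x ^+ 2) * 0)).
    apply: cvgM; [exact: cvg_cst|apply: cvgM; [exact: cvg_cst|exact: expansion]].
  by rewrite !mulr0.
apply: cvg0_of_sqr_le b0; near=> n; have sL := psum_L2 (coef g) n.
rewrite (_ : _ - _ = - K^-1 * J (fun x => f x * (g x - partial_sum (coef g) n x))).
  by rewrite exprMn sqrrN ler_wpM2l ?sqr_ge0 // Cauchy_Schwarz //; exact: in_L2B.
have -> : (fun x => f x * (g x - partial_sum (coef g) n x)) =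
    (fun x => f x * g x - f x * partial_sum (coef g) n x).
  by apply/funext => x; rewrite mulrBr.
rewrite JB //; try exact: in_L2M.
rewrite J_psum // mulrBr !mulNr opprK mulKf ?gt_eqF // addrC seriesEnat /=.
by congr (_ + _); apply: eq_bigr => k _; rewrite mulrC.
Unshelve. all: end_near. Qed.

End OrthogonalSystem.

(** * Primitives of integrable functions *)

Section Interval.
Variable R : realType.
Implicit Types (a b x t : R) (u f phi : R -> R).
Local Notation mu := (@lebesgue_measure R).

Lemma EFin_Rintegral (D : set R) f : measurable D -> in_L1 mu D f ->
  ((Rintegral mu D f)%:E = \int[mu]_(x in D) (f x)%:E)%E.
Proof. by move=> mD fL; rewrite /Rintegral fineK // integrable_fin_num. Qed.

Lemma measurable_Icc a b : measurable (Icc a b).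
Proof. exact: measurable_itv. Qed.

Lemma in_Icc a b x : Icc a b x <-> a <= x <= b.
Proof. by rewrite /Icc /= in_itv.
Qed.

Lemma Icc_lty a b : (mu (Icc a b) < +oo)%E.
Proof.
by rewrite /Icc lebesgue_measure_itv /=; case: ifP => _; rewrite -?EFinD ltry.
Qed.

Lemma continuous_in_L1 a b f : continuous f -> in_L1 mu (Icc a b) f.
Proof.
move=> cf; apply: continuous_compact_integrable; first exact: segment_compact.
exact: continuous_subspaceT.
Qed.

Lemma continuous_bounded a b f : continuous f ->
  exists2 M, 0 <= M & forall x, Icc a b x -> `|f x| <= M.
Proof.
move=> cf; have [ab|ba] := leP a b; last first.
  exists 0 => // x /in_Icc /andP[ax xb].
  by have := le_trans ax xb; rewrite leNgt ba.
have cn : {within `[a, b], continuous (fun x => `|f x|)}.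
  apply: continuous_subspaceT => x.
  by apply: (@cvg_norm _ _ _ (nbhs x) _ f (f x)); exact: cf.
have [c _ hc] := EVT_max ab cn; by exists `|f c|.
Qed.

Lemma Rintegral_derive a b f (F : R -> R) : a <= b -> continuous f ->
  (forall x, is_derive x 1 F (f x)) ->
  Rintegral mu (Icc a b) f = F b - F a.
Proof.
rewrite le_eqVlt => /orP[/eqP <- _ _|ab cf dF].
  by rewrite /Icc set_itv1 Rintegral_set1 subrr.
have cF : continuous F.
  by move=> x; apply: differentiable_continuous; apply/derivable1_diffP; have [] := dF x.
rewrite /Rintegral /Icc (@continuous_FTC2 _ f F) //.
- exact: continuous_subspaceT.
- split; first by move=> x _; have [] := dF x.
  + exact/cvg_at_right_filter/cF.
  + exact/cvg_at_left_filter/cF.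
- by move=> x _; rewrite derive1E; have [_ ->] := dF x.
Qed.

Lemma in_L1_restrict a b u : in_L1 mu (Icc a b) u ->
  mu.-integrable setT (EFin \o (u \_ (Icc a b))).
Proof.
move=> uL; rewrite -restrict_EFin.
by apply/(integrable_mkcond _ _).1 => //; exact: measurable_Icc.
Qed.

Lemma in_L1_sub a b x u : x <= b -> in_L1 mu (Icc a b) u ->
  in_L1 mu (Icc a x) u.
Proof.
move=> xb; apply: integrableS; [exact: measurable_Icc|exact: measurable_Icc|].
by move=> t /in_Icc /andP[at_ tx]; apply/in_Icc; rewrite at_ (le_trans tx).
Qed.

(* Fubini on the triangle [a <= t <= x <= b]; [u] is merely integrable, so the
   integration by parts of the library does not apply. *)
Lemma by_parts a b u phi (dphi : R -> R) : a <= b -> continuous dphi ->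
  (forall x, is_derive x 1 phi (dphi x)) -> in_L1 mu (Icc a b) u ->
  Rintegral mu (Icc a b) (fun x => u x * phi x) =
  phi b * Rintegral mu (Icc a b) u -
  Rintegral mu (Icc a b) (fun x => dphi x * Rintegral mu (Icc a x) u).
Proof.
move=> ab cd dp uL.
have measurable_I := measurable_Icc a b.
have cp : continuous phi.
  by move=> x; apply: differentiable_continuous; apply/derivable1_diffP;
    have [] := dp x.
pose uI := u \_ (Icc a b); pose dI := dphi \_ (Icc a b).
have mu_uI : measurable_fun setT uI.
  by have /(measurable_int mu)/measurable_EFinP := in_L1_restrict uL.
have mdI : measurable_fun setT dI.
  by have /(measurable_int mu)/measurable_EFinP :=
    in_L1_restrict (continuous_in_L1 a b cd).
(* Here [p.1] is [x] and [p.2] is [t]. Integrating in [t] first gives [dphi x] times the primitive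
   of [u]; integrating in [x] first gives [u t * (phi b - phi t)]. *)
pose F (p : R * R) : R := if p.2 <= p.1 then uI p.2 * dI p.1 else 0.
have mF : measurable_fun setT F.
  apply: measurable_fun_ifT.
  - by apply: measurable_fun_ler; [exact: measurable_snd|exact: measurable_fst].
  - apply: measurable_funM.
      exact: (measurableT_comp mu_uI measurable_snd).
    exact: (measurableT_comp mdI measurable_fst).
  - exact: measurable_cst.
have [M M0 hM] := continuous_bounded a b cd.
have dIM x : `|dI x| <= (cst M \_ (Icc a b)) x.
  by rewrite /dI !patchE; case: ifPn => [/set_mem /hM //|_]; rewrite normr0.
have intF : (mu \x mu)%E.-integrable setT (EFin \o F).
  apply/integrable12ltyP; first exact/measurable_EFinP.
  pose B := (\int[mu]_t `|(uI t)%:E|)%E.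
  have Blty : (B < +oo)%E by have /integrableP[] := in_L1_restrict uL.
  have B0 : (0 <= B)%E by apply: integral_ge0.
  have Bfin : B \is a fin_num by rewrite ge0_fin_numE.
  (* Since [dphi] is bounded by [M] on the interval, the double integral of [|F|] is at most the
     [L^1] norm of [u] times the integral of [M]. *)
  apply: (@le_lt_trans _ _ (\int[mu]_x (B * ((cst M \_ (Icc a b)) x)%:E)))%E.
    apply: ge0_le_integral => //.
    - by move=> x _; apply: integral_ge0.
    - apply: (@measurable_fun_fubini_tonelli_F _ _ _ _ _ mu
        (fun p : R * R => `|(F p)%:E|%E)) => //.
      by apply: measurableT_comp => //; apply/measurable_EFinP.
    - apply: measurable_funeM; apply/measurable_EFinP.
      by apply/(measurable_restrictT _ _).1 => //; exact: measurable_cst.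
    - move=> x _; rewrite muleC -ge0_integralZl //.
      + apply: ge0_le_integral => //.
        * apply: measurableT_comp => //; apply/measurable_EFinP.
          exact: (measurableT_comp mF (measurable_pair1 x)).
        * apply: measurable_funeM; apply: measurableT_comp => //.
          exact/measurable_EFinP.
        * move=> t _; rewrite /F /=; case: ifPn => _.
            by rewrite lee_fin normrM mulrC ler_wpM2r.
          by rewrite normr0 -EFinM lee_fin mulr_ge0 // (le_trans _ (dIM x)).
      + by apply: measurableT_comp => //; apply/measurable_EFinP.
      + by rewrite lee_fin (le_trans _ (dIM x)).
  rewrite -(fineK Bfin) integralZl //; last first.
    by apply: in_L1_restrict; apply: in_L1_cst => //; exact: Icc_lty.
  rewrite -(fineK (integrable_fin_num _ _)) ?ltry //.
  by apply: in_L1_restrict; apply: in_L1_cst => //; exact: Icc_lty.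
have inner_t x : (\int[mu]_t (F (x, t))%:E =
    (((fun x => dphi x * Rintegral mu (Icc a x) u) \_ (Icc a b)) x)%:E)%E.
  rewrite patchE; case: ifPn => [/set_mem/in_Icc/andP[ax xb]|xI].
    have uLx := in_L1_sub xb uL; have mIx := measurable_Icc a x.
    rewrite -RintegralZl //.
    rewrite EFin_Rintegral; [|exact: measurable_Icc|exact: in_L1Z].
    rewrite [RHS]integral_mkcond; apply: eq_integral => t _.
    rewrite patchE /F /uI /dI /= !patchE (@mem_set _ (Icc a b) x); last first.
      by apply/in_Icc; rewrite ax.
    case: (leP t x) => tx; last first.
      by rewrite memNset // => /in_Icc /andP[_]; rewrite leNgt tx.
    case: (leP a t) => at_.
      rewrite !mem_set; first by rewrite mulrC.
      - by apply/in_Icc; rewrite at_.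
      - by apply/in_Icc; rewrite at_ (le_trans tx).
    by rewrite !memNset ?mul0r // => /in_Icc /andP[]; rewrite leNgt at_.
  rewrite integral0_eq // => t _.
  by rewrite /F /= /dI patchE (negbTE xI) mulr0; case: ifP.
have inner_x t : (\int[mu]_x (F (x, t))%:E =
    (((fun t => u t * (phi b - phi t)) \_ (Icc a b)) t)%:E)%E.
  rewrite patchE; case: ifPn => [/set_mem/in_Icc/andP[at_ tb]|tI].
    have dL := continuous_in_L1 t b cd; have mIx := measurable_Icc t b.
    rewrite -(Rintegral_derive tb cd dp).
    rewrite -RintegralZl //.
    rewrite EFin_Rintegral; [|exact: measurable_Icc|exact: in_L1Z].
    rewrite [RHS]integral_mkcond; apply: eq_integral => x _.
    rewrite patchE /F /uI /dI /= !patchE (@mem_set _ (Icc a b) t); last first.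
      by apply/in_Icc; rewrite at_.
    case: (leP t x) => tx; last first.
      by rewrite memNset // => /in_Icc /andP[]; rewrite leNgt tx.
    case: (leP x b) => xb.
      rewrite !mem_set //.
      - by apply/in_Icc; rewrite tx.
      - by apply/in_Icc; rewrite xb (le_trans at_).
    by rewrite !memNset ?mulr0 // => /in_Icc /andP[_]; rewrite leNgt xb.
  rewrite integral0_eq // => x _.
  by rewrite /F /= /uI patchE (negbTE tI) mul0r; case: ifP.
have := Fubini intF.
under eq_integral => x _ do rewrite inner_t.
under [X in _ = X -> _]eq_integral => t _ do rewrite inner_x.
move=> /(congr1 fine).
have toI (g : R -> R) : fine (\int[mu]_x ((g \_ (Icc a b)) x)%:E)%E =
    Rintegral mu (Icc a b) g.
  by rewrite /Rintegral [in RHS]integral_mkcond restrict_EFin.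
rewrite !toI => ->.
have upL : in_L1 mu (Icc a b) (fun x => u x * phi x).
  have [N _ hN] := continuous_bounded a b cp.
  rewrite (_ : (fun _ => _) = (fun x => phi x * u x)); last first.
    by apply/funext => x; rewrite mulrC.
  apply: (@in_L1_bounded _ _ _ mu _ measurable_I u phi N) => //.
  by apply: measurable_funS (continuous_measurable_fun cp).
have puL : in_L1 mu (Icc a b) (fun x => phi b * u x) by exact: in_L1Z.
have dL : in_L1 mu (Icc a b) (fun x => u x * (phi b - phi x)).
  rewrite (_ : (fun _ => _) = (fun x => phi b * u x - u x * phi x)).
    exact: in_L1B.
  by apply/funext => x; ring.
rewrite -RintegralZl // -RintegralB //.
by apply: eq_Rintegral => x _; ring.
Qed.

(** Lebesgue differentiation: almost everywhere [u] is the derivative of its primitive, which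
    vanishes on a neighbourhood of each interior point. The two endpoints are discarded as null
    sets. *)
Lemma primitive_eq0 a b u : in_L1 mu (Icc a b) u ->
  (forall x, Icc a b x -> Rintegral mu (Icc a x) u = 0) ->
  {ae mu, forall x, Icc a b x -> u x = 0}.
Proof.
move=> uL u0; pose uI := u \_ (Icc a b).
have intu : mu.-integrable setT (EFin \o uI) by exact: in_L1_restrict.
have iu y : mu.-integrable [set` Interval (BLeft a) (BRight y)] (EFin \o uI).
  by apply: integrableS intu => //; exact: measurable_itv.
have h := FTC1 iu (integrable_locally (measurable_Icc a b) uL).
have neg c : {ae mu, forall x, x <> c}.
  exists [set c]; split => //; first exact: lebesgue_measure_set1.
  by move=> x /= /contrapT.
apply: (@filterS3 _ _ (ae_filter_ringOfSetsType mu) _ _ _ _ _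
  (neg a) (neg b) h) => x xa xb hx.
move: (xa) => /eqP xa' /[dup] Ix /in_Icc /andP[ax xb'].
have {}ax : a < x by rewrite lt_neqAle ax eq_sym xa'.
have {}xb' : x < b by rewrite lt_neqAle xb' andbT; apply/eqP.
have [_] := hx ax.
rewrite /uI patchE mem_set // => <-; rewrite derive1E.
rewrite (@near_eq_derive _ _ _ _ (cst 0)) ?derive_cst //.
have xI : x \in `]a, b[ by rewrite in_itv /= ax.
near=> y; have : y \in `]a, b[ by near: y; exact: near_in_itvoo.
rewrite in_itv /= => /andP[ay yb].
transitivity (Rintegral mu (Icc a y) u).
  apply: eq_Rintegral => t /set_mem /in_Icc /andP[at_ ty].
  by rewrite patchE mem_set //; apply/in_Icc; rewrite at_ (le_trans ty) // ltW.
by apply: u0; apply/in_Icc; rewrite !ltW.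
Unshelve. all: by end_near. Qed.

End Interval.

(** * Completeness of the cosines *)

Section StepApproximation.
Variable R : realType.
Implicit Types (s t : R) (m n : nat).

Lemma bernoulli_ge t m : 0 <= t -> 1 + m%:R * t <= (1 + t) ^+ m.
Proof.
move=> t0; elim: m => [|m ih]; first by rewrite mul0r addr0 expr0.
rewrite exprS -natr1; apply: (le_trans _ (ler_wpM2l _ ih)); last by lra.
by have := mulr_ge0 (mulr_ge0 (ler0n R m) t0) t0; lra.
Qed.

Lemma bernoulli_le t m : 0 <= t <= 1 -> 1 - m%:R * t <= (1 - t) ^+ m.
Proof.
move=> /andP[t0 t1]; elim: m => [|m ih]; first by rewrite mul0r subr0 expr0.
rewrite exprS -natr1; apply: (le_trans _ (ler_wpM2l _ ih)); last by lra.
by have := mulr_ge0 (mulr_ge0 (ler0n R m) t0) t0; lra.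
Qed.

(* Tends to [1] for [s < 1/2] and to [0] for [1/2 < s <= 1], by Bernoulli's
   inequality on both sides. *)
Definition step_approx n s : R := (1 - s ^+ n) ^+ (2 ^ n)%N.

Lemma step_01 n s : 0 <= s <= 1 -> 0 <= step_approx n s <= 1.
Proof.
move=> /andP[s0 s1]; have sn : 0 <= 1 - s ^+ n <= 1.
  by rewrite subr_ge0 exprn_ile1 //= gerBl exprn_ge0.
by case/andP: sn => h0 h1; rewrite exprn_ge0 ?exprn_ile1.
Qed.

Lemma geometric_cvg0 s : 0 <= s < 1 -> s ^+ n @[n --> \oo] --> 0.
Proof. by move=> /andP[s0 s1]; apply: cvg_expr; rewrite ger0_norm. Qed.

Lemma step_cvg1 s : 0 <= s -> s < 2^-1 -> step_approx n s @[n --> \oo] --> (1 : R).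
Proof.
move=> s0 s2; have s1 : 0 <= s <= 1 by apply/andP; split; lra.
apply: (@squeeze_cvgr _ _ _ _ (fun n => 1 - (2 * s) ^+ n) (fun=> 1)).
- near=> n; have /andP[_ ->] := step_01 n s1; rewrite andbT.
  rewrite exprMn -natrX; apply: bernoulli_le.
  by case/andP: s1 => *; rewrite exprn_ge0 ?exprn_ile1.
- rewrite [X in _ --> X](_ : 1 = 1 - 0); last by rewrite subr0.
  apply: cvgB; first exact: cvg_cst.
  by apply: geometric_cvg0; apply/andP; split; lra.
- exact: cvg_cst.
Unshelve. all: by end_near. Qed.

Lemma step_cvg0 s : 2^-1 < s -> s <= 1 -> step_approx n s @[n --> \oo] --> (0 : R).
Proof.
move=> s2 s1; have s0 : 0 <= s by lra.
have s01 : 0 <= s <= 1 by rewrite s0.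
have t0 : 0 < 2 * s by lra.
apply: (@squeeze_cvgr _ _ _ _ (fun=> 0) (fun n => (2 * s)^-1 ^+ n)).
- near=> n; have /andP[-> _] := step_01 n s01; rewrite /= exprVn.
  rewrite -[leRHS]mul1r ler_pdivlMr ?exprn_gt0 //.
  (* Bernoulli bounds $(2s)^n$ by $(1+s^n)^{2^n}$, and the product of the latter with
     [step_approx n s] is $(1-s^{2n})^{2^n} \le 1$. *)
  have h1 : (2 * s) ^+ n <= (1 + s ^+ n) ^+ (2 ^ n)%N.
    apply: le_trans (bernoulli_ge _ (exprn_ge0 _ s0)).
    by rewrite exprMn natrX lerDr.
  apply: (le_trans (ler_wpM2l _ h1)).
    by have /andP[] := step_01 n s01.
  rewrite /step_approx -exprMn -subr_sqr expr1n; apply: exprn_ile1.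
    by rewrite subr_ge0 -exprM exprn_ile1.
  by rewrite gerBl sqr_ge0.
- exact: cvg_cst.
- apply: geometric_cvg0; rewrite invr_ge0 ltW //= invf_lt1 //; lra.
Unshelve. all: by end_near. Qed.

End StepApproximation.

(** * Trigonometric integrals and [L^1] completeness of the cosines *)

Section Trig.
Variable R : realType.
Implicit Types (a b c x t : R) (u f g : R -> R) (j k m n : nat).
Local Notation mu := (@lebesgue_measure R).
Local Notation I := (Icc 0 (pi : R)).
Local Notation J f := (Rintegral mu I f).
Local Notation in_L1 := (in_L1 mu I).
Local Notation in_L2 := (in_L2 mu I).

Lemma is_derive_sinM c x : is_derive x 1 (fun x => sin (c * x)) (c * cos (c * x)).
Proof.
have h : is_derive x 1 (fun x : R => c * x) c.
  by rewrite -[X in is_derive _ _ _ X]mulr1; exact: (is_deriveZ c (is_derive_id x 1)).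
by rewrite mulrC; exact: (is_derive1_comp (is_derive_sin _) h).
Qed.

Lemma is_derive_cosM c x :
  is_derive x 1 (fun x => cos (c * x)) (- (c * sin (c * x))).
Proof.
have h : is_derive x 1 (fun x : R => c * x) c.
  by rewrite -[X in is_derive _ _ _ X]mulr1; exact: (is_deriveZ c (is_derive_id x 1)).
by rewrite mulrC -mulNr; exact: (is_derive1_comp (is_derive_cos _) h).
Qed.

Lemma continuous_sinM c : continuous (fun x => sin (c * x)).
Proof.
move=> x; apply: differentiable_continuous; apply/derivable1_diffP.
by have [] := is_derive_sinM c x.
Qed.

Lemma continuous_cosM c : continuous (fun x => cos (c * x)).
Proof.
move=> x; apply: differentiable_continuous; apply/derivable1_diffP.
by have [] := is_derive_cosM c x.
Qed.

Lemma measurable_sinM (D : set R) c : measurable_fun D (fun x => sin (c * x)).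
Proof.
apply: measurable_funS (continuous_measurable_fun (@continuous_sinM c)) => //.
Qed.

Lemma measurable_cosM (D : set R) c : measurable_fun D (fun x => cos (c * x)).
Proof.
apply: measurable_funS (continuous_measurable_fun (@continuous_cosM c)) => //.
Qed.

Lemma norm_sin_le1 x : `|sin x| <= 1.
Proof. by rewrite ler_norml sin_geN1 sin_le1. Qed.

Lemma norm_cos_le1 x : `|cos x| <= 1.
Proof. by rewrite ler_norml cos_geN1 cos_le1. Qed.

Lemma sin_natpi k : sin (k%:R * pi) = 0 :> R.
Proof.
elim: k => [|k ih]; first by rewrite mul0r sin0.
by rewrite -natr1 mulrDl mul1r sinDpi ih oppr0.
Qed.

Lemma Icc_pi x : I x <-> 0 <= x <= pi.
Proof. exact: in_Icc. Qed.

Lemma measurable_I : measurable I. Proof. exact: measurable_Icc. Qed.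

Lemma mu_I_lty : (mu I < +oo)%E. Proof. exact: Icc_lty. Qed.

Lemma eq_in_L1 f g : (forall x, I x -> f x = g x) -> in_L1 f -> in_L1 g.
Proof.
move=> fg; apply: (@in_L1_eq _ _ _ mu I measurable_I f g) => x /set_mem.
exact: fg.
Qed.

Lemma J_cst c : J (fun=> c) = c * pi.
Proof.
rewrite Rintegral_cst; last exact: measurable_I.
have e : mu I = pi%:E.
  by rewrite /Icc lebesgue_measure_itv /= lte_fin pi_gt0 -EFinD subr0.
by congr (_ * _); exact: (congr1 fine e).
Qed.

Lemma J_cos k : J (fun x => cos (k%:R * x)) = pi * (k == 0)%:R.
Proof.
case: k => [|k] /=.
  rewrite (@eq_J _ _ _ mu I _ (fun=> 1)) ?J_cst ?mulr1 ?mul1r // => x _.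
  by rewrite mul0r cos0.
have k0 : k.+1%:R != 0 :> R by rewrite pnatr_eq0.
rewrite (@eq_J _ _ _ mu I _ (fun x => k.+1%:R^-1 * (k.+1%:R * cos (k.+1%:R * x)))).
  rewrite JZ //.
  - have cc : continuous (fun x => k.+1%:R * cos (k.+1%:R * x) : R).
      by move=> x; apply: cvgM; [exact: cvg_cst|exact: continuous_cosM].
    have := Rintegral_derive (pi_ge0 R) cc (is_derive_sinM k.+1%:R).
    by rewrite sin_natpi mulr0 sin0 subrr => ->; rewrite !mulr0.
  - exact: measurable_I.
  - apply: in_L1Z; first exact: measurable_I.
    by apply: continuous_in_L1; exact: continuous_cosM.
by move=> x _; rewrite mulKf.
Qed.

(** [ndist] is [|j - k|] built from truncated subtraction; evenness of the cosine hides the sign. *)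
Lemma cos_ndist j k x : cos ((ndist j k)%:R * x) = cos (j%:R * x - k%:R * x).
Proof.
rewrite /ndist -mulrBl; case: (leqP j k) => [jk|/ltnW kj].
  by rewrite (eqP jk) add0n natrB // -cosN -mulNr opprB.
by rewrite (eqP kj) addn0 natrB.
Qed.

Lemma cosMcos j k x : cos (j%:R * x) * cos (k%:R * x) =
  2^-1 * (cos ((ndist j k)%:R * x) + cos ((j + k)%:R * x)).
Proof. by rewrite cos_ndist natrD mulrDl cosB cosD; field. Qed.

Lemma sinMsin j k x : sin (j%:R * x) * sin (k%:R * x) =
  2^-1 * (cos ((ndist j k)%:R * x) - cos ((j + k)%:R * x)).
Proof. by rewrite cos_ndist natrD mulrDl cosB cosD; field. Qed.

Lemma ndist_eq0 j k : (ndist j k == 0)%N = (j == k).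
Proof. by rewrite /ndist addn_eq0 !subn_eq0 eqn_leq. Qed.

Lemma in_L1_cosM f k : in_L1 f -> in_L1 (fun x => f x * cos (k%:R * x)).
Proof.
move=> fL; rewrite (_ : (fun _ => _) = (fun x => cos (k%:R * x) * f x)).
  apply: (@in_L1_bounded _ _ _ mu I measurable_I f _ 1) => //.
    exact: measurable_cosM.
  by move=> x _; exact: norm_cos_le1.
by apply/funext => x; rewrite mulrC.
Qed.

Lemma in_L1_sinM f k : in_L1 f -> in_L1 (fun x => f x * sin (k%:R * x)).
Proof.
move=> fL; rewrite (_ : (fun _ => _) = (fun x => sin (k%:R * x) * f x)).
  apply: (@in_L1_bounded _ _ _ mu I measurable_I f _ 1) => //.
    exact: measurable_sinM.
  by move=> x _; exact: norm_sin_le1.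
by apply/funext => x; rewrite mulrC.
Qed.

(** Multiplying by [cos x] sends [cos kx] to the mean of two cosines with natural frequencies, so
    orthogonality to all cosines is preserved. The induction must therefore keep every [k]. *)
Lemma J_cos_ring f : in_L1 f -> (forall k, J (fun x => f x * cos (k%:R * x)) = 0) ->
  forall n k, J (fun x => f x * cos x ^+ n * cos (k%:R * x)) = 0.
Proof.
move=> fL f0; elim=> [|n ih] k.
  by rewrite -[RHS](f0 k); apply: eq_J => x _; rewrite expr0 mulr1.
have gL : in_L1 (fun x => f x * cos x ^+ n).
  elim: {ih} n => [|n ih].
    by apply: eq_in_L1 fL => x _; rewrite expr0 mulr1.
  apply: eq_in_L1 (in_L1_cosM 1 ih) => x _; rewrite mul1r exprS; ring.
pose g x := f x * cos x ^+ n.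
rewrite (@eq_J _ _ _ mu I _ (fun x => 2^-1 * (g x * cos ((ndist 1 k)%:R * x) +
  g x * cos ((1 + k)%:R * x)))).
  rewrite JZ ?JD ?ih ?addr0 ?mulr0 //; do ?[exact: measurable_I|exact: in_L1_cosM].
  by apply: in_L1D; do ?[exact: measurable_I|exact: in_L1_cosM].
move=> x _; rewrite -mulrDr mulrCA -cosMcos mul1r /g exprS; ring.
Qed.

Lemma J_cos_poly f : in_L1 f -> (forall k, J (fun x => f x * cos (k%:R * x)) = 0) ->
  forall p : {poly R}, J (fun x => f x * p.[cos x]) = 0.
Proof.
move=> fL f0 p; have h := J_cos_ring fL f0.
have gL n : in_L1 (fun x => f x * cos x ^+ n).
  elim: n => [|n ih].
    by apply: eq_in_L1 fL => x _; rewrite expr0 mulr1.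
  apply: eq_in_L1 (in_L1_cosM 1 ih) => x _; rewrite mul1r exprS; ring.
rewrite (@eq_J _ _ _ mu I _
  (fun x => \sum_(0 <= i < size p) p`_i * (f x * cos x ^+ i))).
  rewrite J_sum; [|exact: measurable_I|by move=> k; apply: in_L1Z; [exact: measurable_I|exact: gL]].
  apply: big1_seq => i _; rewrite JZ; [|exact: measurable_I|exact: gL].
  rewrite [X in _ * X](_ : _ = 0) ?mulr0 // -[RHS](h i 0%N).
  by apply: eq_J => x _; rewrite mul0r cos0 mulr1.
move=> x _; rewrite horner_coef mulr_sumr big_mkord.
by apply: eq_bigr => i _; rewrite mulrCA.
Qed.

(* As [|c - cos x| <= 2], the argument [1/2 + (c - cos x)/4] stays in [0, 1];
   it crosses [1/2] where [cos x] crosses [c]. *)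
Definition step_poly c n : {poly R} :=
  (1 - ((2^-1 + c / 4)%:P - (4^-1)%:P * 'X) ^+ n) ^+ (2 ^ n)%N.

Lemma step_polyE c n t : (step_poly c n).[t] = step_approx n (2^-1 + (c - t) / 4).
Proof.
rewrite /step_poly /step_approx !(hornerE, horner_exp); congr ((1 - _ ^+ _) ^+ _).
by field.
Qed.

Lemma L1_cos_eq0 f : in_L1 f ->
  (forall k, J (fun x => f x * cos (k%:R * x)) = 0) ->
  {ae mu, forall x, I x -> f x = 0}.
Proof.
move=> fL f0; apply: primitive_eq0 => // a /Icc_pi /andP[a0 api].
(* Cosine decreases strictly on [[0, pi]], so [cos x > c] means [x < a]: a threshold on the value of
   the cosine becomes the indicator of an initial segment. *)
pose c := cos a; pose q n x := (step_poly c n).[cos x].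
have cos_bnd x : 0 <= 2^-1 + (c - cos x) / 4 <= 1.
  have := (cos_geN1 x, cos_le1 x, cos_geN1 a, cos_le1 a).
  by case=> -[[]]; rewrite -/c => *; apply/andP; split; lra.
have q01 n x : 0 <= q n x <= 1 by rewrite /q step_polyE step_01.
have cq n : continuous (q n).
  by move=> x; apply: continuous_comp; [exact: continuous_cos|exact: continuous_horner].
have mq n : measurable_fun I (q n).
  by apply: measurable_funS (continuous_measurable_fun (cq n)).
have mf := in_L1_measurable fL.
pose g x := f x * (x < a)%R%:R.
have mg : measurable_fun I g.
  apply: measurable_funM => //.
  rewrite (_ : (fun _ => _) = \1_`]-oo, a[); first exact: measurable_indic.
  by apply/funext => x; rewrite indicE mem_setE in_itv.
have q_cvg x : I x -> x <> a -> q n x @[n --> \oo] --> ((x < a)%R%:R : R).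
  move=> /Icc_pi /andP[x0 xpi] xa; rewrite /q.
  under eq_fun do rewrite step_polyE.
  have xI : x \in `[0, pi] by rewrite in_itv /= x0.
  have aI : a \in `[0, pi] by rewrite in_itv /= a0.
  have /andP[b0 b1] := cos_bnd x.
  case: ltgtP xa => // [xa _|xa _].
    have : cos a < cos x by rewrite ltr_cos.
    by rewrite -/c => h; apply: step_cvg1 => //; lra.
  have : cos x < cos a by rewrite ltr_cos.
  by rewrite -/c => h; apply: step_cvg0 => //; lra.
have neg : {ae mu, forall x, x <> a}.
  exists [set a]; split => //; first exact: lebesgue_measure_set1.
  by move=> x /= /contrapT.
have f_g : {ae mu, forall x, I x ->
    (f x * q n x)%:E @[n --> \oo] --> (g x)%:E}.
  apply: (@filterS _ _ (ae_filter_ringOfSetsType mu) _ _ _ neg) => x xa Ix; apply/cvg_EFin; first by near=> n.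
  by apply: cvgM; [exact: cvg_cst|exact: q_cvg].
have mfq n : measurable_fun I (fun x => (f x * q n x)%:E).
  by apply/measurable_EFinP; exact: measurable_funM.
have nfL : mu.-integrable I (fun x => `|f x|%:E) by exact: integrable_norm.
(* The approximants lie in [[0, 1]], so [|f|] itself dominates and integrability of [f] is
   enough. *)
have dom : {ae mu, forall x, forall n, I x -> (`|(f x * q n x)%:E| <= `|f x|%:E)%E}.
  apply: aeW => x n Ix; rewrite lee_fin normrM; have /andP[q0 q1] := q01 n x.
  by rewrite (ger0_norm q0) ler_piMr.
have mgE : measurable_fun I (fun x => (g x)%:E) by exact/measurable_EFinP.
have [gL _ cv] := @dominated_convergence _ _ _ mu I measurable_I _ _ _ mfq mgE f_g nfL dom.
have z : (fun n => (\int[mu]_(x in I) (f x * q n x)%:E)%E) = fun=> 0%E.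
  apply/funext => n.
  rewrite -EFin_Rintegral; [by rewrite (J_cos_poly fL f0)|exact: measurable_I|].
  apply: (@eq_in_L1 (fun x => q n x * f x)) => [x _|]; first by rewrite mulrC.
  apply: (@in_L1_bounded _ _ _ mu I measurable_I f (q n) 1) => //.
    exact: mq.
  by move=> x _; have /andP[q0 q1] := q01 n x; rewrite ger0_norm.
have g0 : (\int[mu]_(x in I) (g x)%:E)%E = 0%E.
  have cv0 : (fun=> 0%E) @ \oo --> (\int[mu]_(x in I) (g x)%:E)%E.
    by rewrite -z; exact: cv.
  by apply: (cvg_unique _ cv0); [exact: ereal_hausdorff|exact: cvg_cst].
have -> : Icc 0 a = I `&` Icc 0 a.
  by rewrite setIidr // => x /in_Icc /andP[x0 xa]; apply/in_Icc; rewrite x0 (le_trans xa).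
rewrite Rintegral_mkcondr -[RHS]/(fine 0%E) -g0.
rewrite /Rintegral; congr fine; apply: ae_eq_integral => //.
- exact: measurable_I.
- apply/measurable_EFinP; apply/measurable_restrict => //; first exact: measurable_Icc.
  exact: measurable_I.
  by apply: measurable_funS mf => //; exact: measurable_I.
(* The limit [g] uses [x < a] while the primitive integrates over the closed [[0, a]]; they differ
   at most at [a]. *)
- apply: (@filterS _ _ (ae_filter_ringOfSetsType mu) _ _ _ neg) => x xa /Icc_pi /andP[x0 _]; rewrite /g patchE; congr EFin.
  case: ifPn => [/set_mem/in_Icc/andP[_ xa']|].
    by rewrite lt_neqAle xa' andbT; move/eqP: xa => ->; rewrite mulr1.
  move=> h; case: ltP => xa'; rewrite ?mulr0 //.
  by move: h; rewrite mem_set //; apply/in_Icc; rewrite x0 ltW.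
Unshelve. all: by end_near. Qed.

End Trig.

(** * Sine and cosine series *)

Section TrigSystems.
Variable R : realType.
Implicit Types (a b c x t : R) (u f g q y p w : R -> R) (j k m n : nat).
Local Notation mu := (@lebesgue_measure R).
Local Notation I := (Icc 0 (pi : R)).
Local Notation J f := (Rintegral mu I f).
Local Notation in_L1 := (in_L1 mu I).
Local Notation in_L2 := (in_L2 mu I).
Local Notation r2 := (Num.sqrt (2 : R)).

Lemma sqrt2_sqr : r2 * r2 = 2.
Proof. by rewrite -expr2 sqr_sqrtr. Qed.

Lemma sqrt2_neq0 : r2 != 0.
Proof. by rewrite gt_eqF // sqrtr_gt0. Qed.

Lemma pi_neq0 : (pi : R) != 0. Proof. by rewrite gt_eqF ?pi_gt0. Qed.

(* [R] carries two measurable structures that are convertible but not unified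
   by inference; the [_pi] lemmas fix the one of [lebesgue_measure]. *)
Lemma in_L1D_pi f g : in_L1 f -> in_L1 g -> in_L1 (fun x => f x + g x).
Proof. by apply: in_L1D; exact: measurable_I. Qed.
Lemma in_L1B_pi f g : in_L1 f -> in_L1 g -> in_L1 (fun x => f x - g x).
Proof. by apply: in_L1B; exact: measurable_I. Qed.
Lemma in_L1Z_pi c f : in_L1 f -> in_L1 (fun x => c * f x).
Proof. by apply: in_L1Z; exact: measurable_I. Qed.
Lemma JD_pi f g : in_L1 f -> in_L1 g -> J (fun x => f x + g x) = J f + J g.
Proof. by apply: JD; exact: measurable_I. Qed.
Lemma JB_pi f g : in_L1 f -> in_L1 g -> J (fun x => f x - g x) = J f - J g.
Proof. by apply: JB; exact: measurable_I. Qed.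
Lemma JZ_pi c f : in_L1 f -> J (fun x => c * f x) = c * J f.
Proof. by apply: JZ; exact: measurable_I. Qed.
Lemma eq_J_pi f g : (forall x, I x -> f x = g x) -> J f = J g.
Proof. by move=> fg; apply: eq_J. Qed.
Lemma in_L2M_pi f g : in_L2 f -> in_L2 g -> in_L1 (fun x => f x * g x).
Proof. by apply: in_L2M; exact: measurable_I. Qed.
Lemma in_L2_L1_pi f : in_L2 f -> in_L1 f.
Proof. by apply: in_L2_L1; [exact: measurable_I|exact: mu_I_lty]. Qed.
Lemma in_L1_cst_pi c : in_L1 (fun=> c).
Proof. by apply: in_L1_cst; [exact: measurable_I|exact: mu_I_lty]. Qed.

(** Shifted by one: orthogonal systems are indexed from 0, sines start at frequency 1. *)
Definition esin k x : R := r2 * sin (k.+1%:R * x).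
(** The constant mode needs factor 1 and the others the square root of 2 to share the squared norm
    [pi]. *)
Definition cos_norm k : R := if k is 0 then 1 else r2.
Definition ecos k x : R := cos_norm k * cos (k%:R * x).

Lemma in_L2_sin c : in_L2 (fun x => sin (c * x)).
Proof.
apply: (@in_L2_of_bounded _ _ _ mu I (@measurable_I R) (@mu_I_lty R) _ 1); first exact: measurable_sinM.
by move=> x _; exact: norm_sin_le1.
Qed.

Lemma in_L2_cos c : in_L2 (fun x => cos (c * x)).
Proof.
apply: (@in_L2_of_bounded _ _ _ mu I (@measurable_I R) (@mu_I_lty R) _ 1); first exact: measurable_cosM.
by move=> x _; exact: norm_cos_le1.
Qed.

Lemma in_L2Z_pi c f : in_L2 f -> in_L2 (fun x => c * f x).
Proof. by apply: in_L2Z; exact: measurable_I. Qed.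

Lemma esin_L2 k : in_L2 (esin k).
Proof. by apply: in_L2Z_pi; exact: in_L2_sin. Qed.

Lemma ecos_L2 k : in_L2 (ecos k).
Proof. by apply: in_L2Z_pi; exact: in_L2_cos. Qed.

Lemma in_L2_cosM f k : in_L2 f -> in_L2 (fun x => f x * cos (k%:R * x)).
Proof.
move=> fL; rewrite (_ : (fun _ => _) = (fun x => cos (k%:R * x) * f x)).
  apply: (@in_L2_bounded _ _ _ mu I (@measurable_I R) f _ 1) => //; first exact: measurable_cosM.
  by move=> x _; exact: norm_cos_le1.
by apply/funext => x; rewrite mulrC.
Qed.

Lemma in_L2_sinM f k : in_L2 f -> in_L2 (fun x => f x * sin (k%:R * x)).
Proof.
move=> fL; rewrite (_ : (fun _ => _) = (fun x => sin (k%:R * x) * f x)).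
  apply: (@in_L2_bounded _ _ _ mu I (@measurable_I R) f _ 1) => //; first exact: measurable_sinM.
  by move=> x _; exact: norm_sin_le1.
by apply/funext => x; rewrite mulrC.
Qed.

Lemma in_L1_cos k : in_L1 (fun x => cos (k%:R * x)).
Proof. by apply: continuous_in_L1; exact: continuous_cosM. Qed.

Lemma esin_orth j k : J (fun x => esin j x * esin k x) = pi * (j == k)%:R.
Proof.
rewrite (@eq_J_pi _ (fun x => cos ((ndist j.+1 k.+1)%:R * x) -
  cos ((j.+1 + k.+1)%:R * x))).
  rewrite JB_pi; do ?exact: in_L1_cos.
  by rewrite !J_cos ndist_eq0 addSn mulr0 subr0 eqSS.
move=> x _; rewrite /esin mulrACA sinMsin sqrt2_sqr; by field.
Qed.

Lemma ecos_orth j k : J (fun x => ecos j x * ecos k x) = pi * (j == k)%:R.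
Proof.
rewrite (@eq_J_pi _ (fun x => cos_norm j * cos_norm k / 2 * (cos ((ndist j k)%:R * x) +
  cos ((j + k)%:R * x)))).
  rewrite JZ_pi ?JD_pi ?J_cos; do ?exact: in_L1_cos; last first.
    by apply: in_L1D_pi; exact: in_L1_cos.
  rewrite ndist_eq0 addn_eq0.
  case: j k => [|j] [|k] //=; rewrite ?eqSS ?mulr0 ?addr0 ?mulr0 //.
    by field.
  by case: eqP => _; rewrite ?mulr0 // sqrt2_sqr; field.
by move=> x _; rewrite /ecos mulrACA cosMcos; field.
Qed.

Local Notation csin := (coef mu I esin pi).
Local Notation ccos := (coef mu I ecos pi).

Lemma ecos_eq0 f : in_L2 f -> (forall k, ccos f k = 0) ->
  {ae mu, forall x, I x -> f x = 0}.
Proof.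
move=> fL f0; apply: L1_cos_eq0 => [|k]; first exact: in_L2_L1_pi.
have := f0 k; rewrite /coef.
rewrite (@eq_J_pi _ (fun x => cos_norm k * (f x * cos (k%:R * x)))); last first.
  by move=> x _; rewrite /ecos mulrCA.
rewrite JZ_pi; last by apply: in_L1_cosM; exact: in_L2_L1_pi.
move=> /eqP; rewrite !mulf_eq0 invr_eq0 (negbTE pi_neq0) /=.
by case: k => [|k] /=; rewrite ?oner_eq0 ?(negbTE sqrt2_neq0) /= => /eqP.
Qed.

(** Indexed by frequency, like [fcoef] and unlike [csin], so that it accepts the arguments
    [ndist k m] and [k + m] of the kernel. *)
Definition sin_coef f k := pi^-1 * J (fun x => f x * (r2 * sin (k%:R * x))).

Lemma coef_esin f k : csin f k = sin_coef f k.+1.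
Proof. by []. Qed.

Lemma sin_coefE f k : in_L1 f -> sin_coef f k = r2 / pi * J (fun x => f x * sin (k%:R * x)).
Proof.
move=> fL; rewrite /sin_coef (@eq_J_pi _ (fun x => r2 * (f x * sin (k%:R * x)))).
  by rewrite JZ_pi; [rewrite mulrA [_ * r2]mulrC|exact: in_L1_sinM].
by move=> x _; rewrite mulrCA.
Qed.

Lemma coef_ecosS f k : in_L1 f ->
  ccos f k.+1 = r2 / pi * J (fun x => f x * cos (k.+1%:R * x)).
Proof.
move=> fL; rewrite /coef (@eq_J_pi _ (fun x => r2 * (f x * cos (k.+1%:R * x)))).
  by rewrite JZ_pi; [rewrite mulrA [_ * r2]mulrC|exact: in_L1_cosM].
by move=> x _; rewrite /ecos mulrCA.
Qed.

Lemma coef_ecos0 f : ccos f 0 = pi^-1 * J f.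
Proof.
rewrite /coef; congr (_ * _); apply: eq_J_pi => x _.
by rewrite /ecos /= mul0r cos0 !mulr1.
Qed.

Lemma sinMcos j k x : sin (j%:R * x) * cos (k%:R * x) =
  2^-1 * (sin ((j + k)%:R * x) + sin (j%:R * x - k%:R * x)).
Proof. by rewrite natrD mulrDl sinB sinD; field. Qed.

(* [f sin] is orthogonal to every cosine, so completeness of sines follows
   from that of cosines. *)
Lemma esin_eq0 f : in_L2 f -> (forall k, csin f k = 0) ->
  {ae mu, forall x, I x -> f x = 0}.
Proof.
move=> fL f0; have fL1 := in_L2_L1_pi fL.
have f0' k : J (fun x => f x * sin (k%:R * x)) = 0.
  case: k => [|k].
    rewrite (@eq_J_pi _ (fun x => 0)) ?J_cst ?mul0r // => x _.
    by rewrite mul0r sin0 mulr0.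
  have /eqP := f0 k; rewrite coef_esin sin_coefE // !mulf_eq0 invr_eq0.
  by rewrite (negbTE pi_neq0) (negbTE sqrt2_neq0) /= => /eqP.
have h : {ae mu, forall x, I x -> f x * sin (1%:R * x) = 0}.
  apply: L1_cos_eq0 => [|k]; first exact: in_L1_sinM.
  case: k => [|k].
    rewrite -[RHS](f0' 1%N); apply: eq_J_pi => x _.
    by rewrite mul0r cos0 mulr1.
  rewrite (@eq_J_pi _ (fun x => 2^-1 * (f x * sin (k.+2%:R * x) -
    f x * sin (k%:R * x)))).
    rewrite JZ_pi ?JB_pi ?f0' ?subr0 ?mulr0 //; do ?exact: in_L1_sinM.
    by apply: in_L1B_pi; exact: in_L1_sinM.
  move=> x _; rewrite -mulrA sinMcos add1n.
  rewrite (_ : 1%:R * x - k.+1%:R * x = - (k%:R * x)).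
    by rewrite sinN; field.
  by rewrite -natr1; ring.
have neg c : {ae mu, forall x, x <> c}.
  exists [set c]; split => //; first exact: lebesgue_measure_set1.
  by move=> x /= /contrapT.
(* Away from the two endpoints [sin x] is positive and can be cancelled. *)
apply: (@filterS3 _ _ (ae_filter_ringOfSetsType mu) _ _ _ _ _
  (neg 0) (neg pi) h) => x x0 xpi hx Ix.
have /eqP := hx Ix; rewrite mul1r mulf_eq0 => /orP[/eqP //|].
rewrite gt_eqF //; apply: sin_gt0_pi.
move/Icc_pi: Ix => /andP[h0 h1]; rewrite !lt_neqAle h0 h1 eq_sym !andbT.
by apply/andP; split; apply/eqP.
Qed.

(** * Integration by parts and the weak form of the equation *)

Local Notation prim u x := (Rintegral mu (Icc 0 x) u).

(** The primitive is continuous and bounded by the integral of [|u|]. *)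
Lemma primitive_L2 u : in_L1 u -> in_L2 (fun x => prim u x).
Proof.
move=> uL.
have mp : measurable_fun I (fun x => prim u x).
  apply: subspace_continuous_measurable_fun; first exact: measurable_Icc.
  exact: (@parameterized_integral_continuous _ 0 pi u (pi_ge0 R) uL).
apply: (@in_L2_of_bounded _ _ _ mu I (@measurable_I R) (@mu_I_lty R) _ (J (fun x => `|u x|))) => //.
move=> x /Icc_pi /andP[x0 xpi].
have uLx := in_L1_sub xpi uL.
have nL : in_L1 (fun t => `|u t|) by exact: integrable_norm.
apply: (le_trans (le_normr_Rintegral _ uLx)); first exact: measurable_Icc.
have sub : Icc 0 x `<=` I.
  by move=> t /in_Icc /andP[t0 tx]; apply/Icc_pi; rewrite t0 (le_trans tx).
rewrite -lee_fin EFin_Rintegral; [|exact: measurable_Icc|exact: in_L1_sub nL].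
rewrite EFin_Rintegral //; last exact: measurable_I.
apply: ge0_subset_integral => //; [exact: measurable_Icc|exact: measurable_I|].
by have /(measurable_int mu) := nL.
Qed.

Lemma primitive_at0 u : prim u 0 = 0.
Proof. by rewrite /Icc set_itv1 Rintegral_set1. Qed.

Lemma by_parts_sin u k : in_L1 u -> J (fun x => u x * sin (k%:R * x)) =
  - (k%:R * J (fun x => prim u x * cos (k%:R * x))).
Proof.
move=> uL; have cc : continuous (fun x => k%:R * cos (k%:R * x) : R).
  by move=> x; apply: cvgM; [exact: cvg_cst|exact: continuous_cosM].
rewrite (by_parts (pi_ge0 R) cc (is_derive_sinM k%:R) uL).
rewrite sin_natpi mul0r sub0r -JZ_pi; last first.
  by apply: in_L1_cosM; apply: in_L2_L1_pi; exact: primitive_L2.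
by congr (- _); apply: eq_J_pi => x _; ring.
Qed.

(** Cosines do not vanish at [pi]; the boundary term disappears through [prim u pi = 0], which
    stands for the condition [y(pi) = 0] when [u = y']. *)
Lemma by_parts_cos u k : in_L1 u -> prim u pi = 0 ->
  J (fun x => u x * cos (k%:R * x)) =
  k%:R * J (fun x => prim u x * sin (k%:R * x)).
Proof.
move=> uL upi; have cc : continuous (fun x => - (k%:R * sin (k%:R * x)) : R).
  by move=> x; apply: cvgN; apply: cvgM; [exact: cvg_cst|exact: continuous_sinM].
rewrite (by_parts (pi_ge0 R) cc (is_derive_cosM k%:R) uL).
rewrite upi mulr0 sub0r -JZ_pi; last first.
  by apply: in_L1_sinM; apply: in_L2_L1_pi; exact: primitive_L2.
rewrite -mulN1r -JZ_pi; first by apply: eq_J_pi => x _; ring.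
rewrite (_ : (fun _ => _) =
  (fun x => (- k%:R) * (prim u x * sin (k%:R * x)))).
  by apply: in_L1Z_pi; apply: in_L1_sinM; apply: in_L2_L1_pi; exact: primitive_L2.
by apply/funext => x; ring.
Qed.

(** Subtracting the mean also annihilates the coefficient of index 0. *)
Lemma L1_cos_cst f : in_L1 f ->
  (forall k, (0 < k)%N -> J (fun x => f x * cos (k%:R * x)) = 0) ->
  {ae mu, forall x, I x -> f x = pi^-1 * J f}.
Proof.
move=> fL f0; set c := _ * _.
have h : {ae mu, forall x, I x -> f x - c = 0}.
  apply: L1_cos_eq0 => [|k]; first by apply: in_L1B_pi => //; exact: in_L1_cst_pi.
  rewrite (@eq_J_pi _ (fun x => f x * cos (k%:R * x) - c * cos (k%:R * x))).
    have cL := in_L1_cos k; have ccL := in_L1Z_pi c cL.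
    rewrite JB_pi ?JZ_pi ?J_cos //; last exact: in_L1_cosM.
    case: k cL ccL => [|k] _ _; last by rewrite f0 // !mulr0 subr0.
    rewrite (@eq_J_pi _ f) => [|x _]; last by rewrite mul0r cos0 mulr1.
    by rewrite /c mulr1 -mulrA [_ * pi]mulrC mulrA mulVf ?pi_neq0 // mul1r subrr.
  by move=> x _; rewrite mulrBl.
apply: (@filterS _ _ (ae_filter_ringOfSetsType mu) _ _ _ h) => x hx Ix.
by apply/eqP; rewrite -subr_eq0 hx.
Qed.

(** For [g = y'] and [p = Q y] this tests [(y' - Q y)' = u] against [sin kx]. Integration by parts
    makes both sides [k] times a cosine integral, and [w0] drops out because [k] is positive. *)
Lemma weak_form u g p (w0 : R) k : in_L1 u -> in_L2 g -> in_L1 p ->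
  prim g pi = 0 ->
  {ae mu, forall x, I x -> g x - p x = w0 + prim u x} -> (0 < k)%N ->
  - J (fun x => u x * sin (k%:R * x)) =
  k%:R ^+ 2 * J (fun x => prim g x * sin (k%:R * x)) -
  k%:R * J (fun x => p x * cos (k%:R * x)).
Proof.
move=> uL gL pL gpi gp k0; have gL1 := in_L2_L1_pi gL.
have UL := in_L2_L1_pi (primitive_L2 uL).
rewrite by_parts_sin // opprK expr2 -mulrA -by_parts_cos // -mulrBr; congr (_ * _).
rewrite -JB_pi; try exact: in_L1_cosM.
transitivity (J (fun x => (w0 + prim u x) * cos (k%:R * x))).
  rewrite (@eq_J_pi (fun x => (w0 + _) * _) (fun x => w0 * cos (k%:R * x) +
    prim u x * cos (k%:R * x))); last by move=> x _; rewrite mulrDl.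
  rewrite JD_pi ?JZ_pi ?J_cos; [|exact: in_L1_cos| |exact: in_L1_cosM].
    by rewrite gtn_eqF // !mulr0 add0r.
  by apply: in_L1Z_pi; exact: in_L1_cos.
apply: (@ae_eq_J _ _ _ mu _ (@measurable_I R)).
- apply: measurable_funM; last exact: measurable_cosM.
  by apply: measurable_funD => //; exact: (in_L1_measurable UL).
- by apply: measurable_funB;
    exact: (in_L1_measurable (in_L1_cosM _ _)).
- apply: (@filterS _ _ (ae_filter_ringOfSetsType mu) _ _ _ gp) => x hx Ix.
  by rewrite -mulrBl hx.
Qed.

(** After division by [k], the hypothesis says that [g - p - prim u] has no cosine coefficient of
    positive index; [w0] is its mean. *)
Lemma weak_form_inv u g p : in_L1 u -> in_L2 g -> in_L1 p ->
  prim g pi = 0 ->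
  (forall k, (0 < k)%N -> - J (fun x => u x * sin (k%:R * x)) =
    k%:R ^+ 2 * J (fun x => prim g x * sin (k%:R * x)) -
    k%:R * J (fun x => p x * cos (k%:R * x))) ->
  exists w0 : R, {ae mu, forall x, I x -> g x - p x = w0 + prim u x}.
Proof.
move=> uL gL pL gpi h; have gL1 := in_L2_L1_pi gL.
have UL := in_L2_L1_pi (primitive_L2 uL).
have dL : in_L1 (fun x => g x - p x - prim u x).
  by apply: in_L1B_pi => //; exact: in_L1B_pi.
exists (pi^-1 * J (fun x => g x - p x - prim u x)).
have z k : (0 < k)%N -> J (fun x => (g x - p x - prim u x) * cos (k%:R * x)) = 0.
  move=> k0; have kn : (k%:R : R) != 0 by rewrite pnatr_eq0 -lt0n.
  have gc := in_L1_cosM k gL1; have pc := in_L1_cosM k pL.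
  have uc := in_L1_cosM k UL; have gpc := in_L1B_pi gc pc.
  rewrite (@eq_J_pi _ (fun x => (g x * cos (k%:R * x) - p x * cos (k%:R * x)) -
    prim u x * cos (k%:R * x))); last by move=> x _; rewrite !mulrBl.
  rewrite !JB_pi ?(by_parts_cos _ gL1) //.
  apply/(mulfI kn); have := h k k0; rewrite by_parts_sin // opprK mulr0 => e.
  by rewrite !mulrBr e; ring.
apply: (@filterS _ _ (ae_filter_ringOfSetsType mu) _ _ _ (L1_cos_cst dL z)).
by move=> x hx Ix; rewrite -(hx Ix) subrK.
Qed.

(** * The convolution series *)

Lemma series_shift (v : R^nat) : v 0%N = 0 ->
  series (fun m => v m.+1) = [sequence series v n.+1]_n.
Proof.
by move=> v0; apply/funext => n; rewrite !seriesEnat /= [RHS]big_nat_recl // v0 add0r.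
Qed.

Lemma cvg_series_shift (v : R^nat) (l : R) : v 0%N = 0 ->
  series v @ \oo --> l -> series (fun m => v m.+1) @ \oo --> l.
Proof. by move=> v0 h; rewrite series_shift // cvg_shiftS. Qed.

Lemma is_cvg_series_shift (v : R^nat) : v 0%N = 0 ->
  cvgn (series (fun m => v m.+1)) -> cvgn (series v).
Proof.
move=> v0 cv; apply/cvg_ex; exists (limn (series (fun m => v m.+1))).
by rewrite -cvg_shiftS; move: cv; rewrite series_shift.
Qed.

(** The function $r \mapsto r\sin(rx)$ is even, so the absolute value in [ndist] may be dropped. *)
Lemma sin_ndist j k x : (ndist j k)%:R * sin ((ndist j k)%:R * x) =
  (j%:R - k%:R) * sin (j%:R * x - k%:R * x).
Proof.
rewrite /ndist -mulrBl; case: (leqP j k) => [jk|/ltnW kj].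
  by rewrite (eqP jk) add0n natrB // -(opprB k%:R) !mulNr sinN mulrN opprK.
by rewrite (eqP kj) addn0 natrB.
Qed.

(** The left side is the integral of [q] against $(\sin kx \sin jx)'$; differentiating $\frac12(\cos
    (k-j)x - \cos (k+j)x)$ instead gives the right side. This is the origin of the kernel
    [Vt |k-m| - Vt (k+m)]. *)
Lemma convolution_term q y k j : in_L2 q ->
  j%:R * J (fun x => q x * sin (k%:R * x) * cos (j%:R * x)) +
  J (fun x => k%:R * (q x * cos (k%:R * x)) * sin (j%:R * x)) =
  2^-1 * ((k + j)%:R * J (fun x => q x * sin ((k + j)%:R * x)) -
    (ndist k j)%:R * J (fun x => q x * sin ((ndist k j)%:R * x))).
Proof.
move=> qL; have qL1 := in_L2_L1_pi qL.
have h1 := in_L1_cosM j (in_L1_sinM k qL1).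
have h2 := in_L1_sinM j (in_L1Z_pi k%:R (in_L1_cosM k qL1)).
have h3 := in_L1_sinM (k + j) qL1; have h4 := in_L1_sinM (ndist k j) qL1.
have h5 := in_L1Z_pi (k + j)%:R h3; have h6 := in_L1Z_pi (ndist k j)%:R h4.
rewrite -!JZ_pi // -JB_pi // -JZ_pi; last exact: in_L1B_pi.
rewrite -JD_pi //; last exact: in_L1Z_pi.
apply: eq_J_pi => x _; rewrite mulrCA [in X in _ - X]mulrCA sin_ndist.
by rewrite natrD (mulrDl _ _ x) sinB sinD; field.
Qed.

(** In [convolution_term] the factor [j] is absorbed by the sine coefficient of the primitive,
    giving the cosine coefficient of [g]; the factor [k] stays with [q]. Both resulting series are
    Parseval sums of square-integrable functions. *)
Lemma convolution_series q g k : in_L2 q -> in_L2 g -> prim g pi = 0 ->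
  series (fun m => ((ndist k m.+1)%:R * sin_coef q (ndist k m.+1) -
                    (k + m.+1)%:R * sin_coef q (k + m.+1)) * sin_coef (fun x => prim g x) m.+1)
    @ \oo -->
  - (2 / pi * J (fun x => q x * (g x * sin (k%:R * x) +
                                 k%:R * prim g x * cos (k%:R * x)))).
Proof.
move=> qL gL gpi; have gL1 := in_L2_L1_pi gL.
pose y x := prim g x.
have yL : in_L2 y by exact: primitive_L2.
pose G x := q x * sin (k%:R * x); pose H x := k%:R * (q x * cos (k%:R * x)).
have GL : in_L2 G by exact: in_L2_sinM.
have HL : in_L2 H by apply: in_L2Z_pi; exact: in_L2_cosM.
have P1 := @parseval _ _ R mu I (@measurable_I R) (@mu_I_lty R) _ pi (pi_gt0 R) ecos_L2 ecos_orth ecos_eq0 _ _ GL gL.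
have P2 := @parseval _ _ R mu I (@measurable_I R) (@mu_I_lty R) _ pi (pi_gt0 R) esin_L2 esin_orth esin_eq0 _ _ HL yL.
have {}P1 := cvg_series_shift _ P1.
(* Cosines are indexed from 0, while the convolution starts at frequency 1; the extra term vanishes
   since [g] has mean zero. *)
have ccos0 : ccos G 0 * ccos g 0 = 0 by rewrite [ccos g 0]coef_ecos0 gpi !mulr0.
have {}P1 := P1 ccos0.
have P : -2 * (series (fun m => ccos G m.+1 * ccos g m.+1) n +
    series (fun m => csin H m * csin y m) n) @[n --> \oo] -->
    -2 * (pi^-1 * J (fun x => G x * g x) + pi^-1 * J (fun x => H x * y x)).
  by apply: cvgM; [exact: cvg_cst|exact: cvgD].
have -> : - (2 / pi * J (fun x => q x * (g x * sin (k%:R * x) +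
    k%:R * y x * cos (k%:R * x)))) =
    -2 * (pi^-1 * J (fun x => G x * g x) + pi^-1 * J (fun x => H x * y x)).
  rewrite -mulrDr -JD_pi; try exact: in_L2M_pi.
  rewrite mulrA -mulNr -mulNr; congr (_ * _).
  by apply: eq_J_pi => x _; rewrite /G /H; ring.
rewrite (_ : series _ = (fun n =>
    -2 * (series (fun m => ccos G m.+1 * ccos g m.+1) n +
    series (fun m => csin H m * csin y m) n))) //.
apply/funext => n.
rewrite !seriesEnat /= -big_split /= mulr_sumr; apply: eq_bigr => m _.
have GL1 := in_L2_L1_pi GL; have HL1 := in_L2_L1_pi HL; have yL1 := in_L2_L1_pi yL.
have qL1 := in_L2_L1_pi qL.
rewrite coef_esin coef_esin !coef_ecosS // (by_parts_cos _ gL1) // !sin_coefE //.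
have := convolution_term y k m.+1 qL; rewrite -/y => e.
set Y := J (fun x => y x * _).
set A := J (fun x => G x * _); set B := J (fun x => H x * _).
have {}e : m.+1%:R * A + B = _ := e.
(* The factor -2 undoes the [2^-1] of [convolution_term] and the opposite order of its two terms. *)
transitivity (-2 * (r2 / pi) * (r2 / pi) * Y * (m.+1%:R * A + B)); last by ring.
by rewrite e; move: (r2 / pi) => r; field.
Qed.

End TrigSystems.

(** * Complex-valued functions *)

Section ComplexValued.
Variable R : realType.
Implicit Types (x a b : R) (z c s : R[i]) (F G Q : R -> R[i]) (j k m n : nat).
Local Notation mu := (@lebesgue_measure R).
Local Notation I := (Icc 0 (pi : R)).
Local Notation J f := (Rintegral mu I f).
Local Notation in_L1 := (in_L1 mu I).
Local Notation in_L2 := (in_L2 mu I).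
Local Notation r2 := (Num.sqrt (2 : R)).
Local Notation re F := (fun x => cre (F x)).
Local Notation im F := (fun x => cim (F x)).
Local Notation prim u x := (Rintegral mu (Icc 0 x) u).

Lemma creD z c : cre (z + c) = cre z + cre c. Proof. by case: z c => ? ? []. Qed.
Lemma cimD z c : cim (z + c) = cim z + cim c. Proof. by case: z c => ? ? []. Qed.
Lemma creN z : cre (- z) = - cre z. Proof. by case: z. Qed.
Lemma cimN z : cim (- z) = - cim z. Proof. by case: z. Qed.
Lemma creM z c : cre (z * c) = cre z * cre c - cim z * cim c.
Proof. by case: z c => ? ? []. Qed.
Lemma cimM z c : cim (z * c) = cre z * cim c + cim z * cre c.
Proof. by case: z c => ? ? []. Qed.
Lemma creZ a z : cre (rC a * z) = a * cre z.
Proof. by rewrite creM /= mul0r subr0. Qed.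
Lemma cimZ a z : cim (rC a * z) = a * cim z.
Proof. by rewrite cimM /= mul0r addr0. Qed.
Lemma creZr a z : cre (z * rC a) = cre z * a.
Proof. by rewrite mulrC creZ mulrC. Qed.
Lemma cimZr a z : cim (z * rC a) = cim z * a.
Proof. by rewrite mulrC cimZ mulrC. Qed.

Definition creimE := (creD, cimD, creN, cimN, creZ, cimZ, creZr, cimZr, creM, cimM).

Lemma eq_creim z c : cre z = cre c -> cim z = cim c -> z = c.
Proof. by case: z c => ? ? [? ?] /= -> ->. Qed.

Lemma rCM a b : rC (a * b) = rC a * rC b.
Proof. by apply: eq_creim; rewrite ?creZ ?cimZ //= mulr0. Qed.

Lemma rC_neq0 a : a != 0 -> rC a != 0.
Proof. by apply: contraNN => /eqP[->]. Qed.

Lemma cL2P F : cL2 I F <-> in_L2 (re F) /\ in_L2 (im F).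
Proof.
split=> [[m1 [m2 i]]|[[m1 i1] [m2 i2]]].
  split; split => //.
    apply: (@in_L1_le _ _ _ mu I (@measurable_I R) _ (fun x => csq (F x))) => //.
      exact: measurable_funX.
    by move=> x _; rewrite ger0_norm ?sqr_ge0 // /csq lerDl sqr_ge0.
  apply: (@in_L1_le _ _ _ mu I (@measurable_I R) _ (fun x => csq (F x))) => //.
    exact: measurable_funX.
  by move=> x _; rewrite ger0_norm ?sqr_ge0 // /csq lerDr sqr_ge0.
split=> //; split=> //.
exact: (in_L1D_pi i1 i2).
Qed.

Lemma cL2_cintegrable F : cL2 I F -> cintegrable I F.
Proof. by move=> /cL2P[h1 h2]; split; exact: in_L2_L1_pi. Qed.

Lemma cintegrableM F G : cL2 I F -> cL2 I G -> cintegrable I (fun x => F x * G x).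
Proof.
move=> /cL2P[f1 f2] /cL2P[g1 g2]; split.
  rewrite [X in mu.-integrable _ X](_ : _ =
    (fun x => (cre (F x) * cre (G x) - cim (F x) * cim (G x))%:E)).
    by apply: in_L1B_pi; exact: in_L2M_pi.
  by apply/funext => x; rewrite creM.
rewrite [X in mu.-integrable _ X](_ : _ =
  (fun x => (cre (F x) * cim (G x) + cim (F x) * cre (G x))%:E)).
  by apply: in_L1D_pi; exact: in_L2M_pi.
by apply/funext => x; rewrite cimM.
Qed.

Lemma cintegrableD F G : cintegrable I F -> cintegrable I G ->
  cintegrable I (fun x => F x + G x).
Proof.
move=> [f1 f2] [g1 g2]; split.
  rewrite [X in mu.-integrable _ X](_ : _ = (fun x => (cre (F x) + cre (G x))%:E)).
    exact: in_L1D_pi.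
  by apply/funext => x; rewrite creD.
rewrite [X in mu.-integrable _ X](_ : _ = (fun x => (cim (F x) + cim (G x))%:E)).
  exact: in_L1D_pi.
by apply/funext => x; rewrite cimD.
Qed.

Lemma cintegrableZ c F : cintegrable I F -> cintegrable I (fun x => c * F x).
Proof.
move=> [f1 f2]; split.
  rewrite [X in mu.-integrable _ X](_ : _ =
    (fun x => (cre c * cre (F x) - cim c * cim (F x))%:E)).
    by apply: in_L1B_pi; exact: in_L1Z_pi.
  by apply/funext => x; rewrite creM.
rewrite [X in mu.-integrable _ X](_ : _ =
  (fun x => (cre c * cim (F x) + cim c * cre (F x))%:E)).
  by apply: in_L1D_pi; exact: in_L1Z_pi.
by apply/funext => x; rewrite cimM.
Qed.

Lemma cintegrableN F : cintegrable I F -> cintegrable I (fun x => - F x).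
Proof.
move=> /(cintegrableZ (-1)); congr cintegrable.
by apply/funext => x; rewrite mulN1r.
Qed.

Lemma cintegrable_sin F k : cintegrable I F ->
  cintegrable I (fun x => F x * rC (sin (k%:R * x))).
Proof.
move=> [f1 f2]; split.
  rewrite [X in mu.-integrable _ X](_ : _ =
    (fun x => (cre (F x) * sin (k%:R * x))%:E)); first exact: in_L1_sinM.
  by apply/funext => x; rewrite creZr.
rewrite [X in mu.-integrable _ X](_ : _ =
  (fun x => (cim (F x) * sin (k%:R * x))%:E)); first exact: in_L1_sinM.
by apply/funext => x; rewrite cimZr.
Qed.

Lemma cintD F G : cintegrable I F -> cintegrable I G ->
  cint 0 pi (fun x => F x + G x) = cint 0 pi F + cint 0 pi G.
Proof.
move=> [f1 f2] [g1 g2]; apply: eq_creim; rewrite !creimE /= -JD_pi //.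
  by apply: eq_J_pi => x _; rewrite creD.
by apply: eq_J_pi => x _; rewrite cimD.
Qed.

Lemma cintZ c F : cintegrable I F ->
  cint 0 pi (fun x => c * F x) = c * cint 0 pi F.
Proof.
move=> [f1 f2]; apply: eq_creim; rewrite !creimE /= -!JZ_pi //.
  rewrite -JB_pi; [|exact: in_L1Z_pi|exact: in_L1Z_pi].
  by apply: eq_J_pi => x _; rewrite creM.
rewrite -JD_pi; [|exact: in_L1Z_pi|exact: in_L1Z_pi].
by apply: eq_J_pi => x _; rewrite cimM.
Qed.

Lemma eq_cint F G : (forall x, I x -> F x = G x) -> cint 0 pi F = cint 0 pi G.
Proof.
by move=> FG; apply: eq_creim => /=; apply: eq_J_pi => x Ix; rewrite FG.
Qed.

Lemma ae_eq_cint F G : cintegrable I F -> cintegrable I G -> ae_eqc I F G ->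
  cint 0 pi F = cint 0 pi G.
Proof.
move=> [f1 f2] [g1 g2] FG; apply: eq_creim => /=; apply: (@ae_eq_J _ _ _ mu _ (@measurable_I R)).
- exact: (in_L1_measurable f1).
- exact: (in_L1_measurable g1).
- apply: (@filterS _ _ (ae_filter_ringOfSetsType mu) _ _ _ FG) => x h Ix.
  by rewrite h.
- exact: (in_L1_measurable f2).
- exact: (in_L1_measurable g2).
- apply: (@filterS _ _ (ae_filter_ringOfSetsType mu) _ _ _ FG) => x h Ix.
  by rewrite h.
Qed.

Definition csinint F k := cint 0 pi (fun x => F x * rC (sin (k%:R * x))).
Definition ccosint F k := cint 0 pi (fun x => F x * rC (cos (k%:R * x))).

Lemma cre_csinint F k : cre (csinint F k) = J (fun x => cre (F x) * sin (k%:R * x)).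
Proof. by apply: eq_J_pi => x _; rewrite creZr. Qed.

Lemma cim_csinint F k : cim (csinint F k) = J (fun x => cim (F x) * sin (k%:R * x)).
Proof. by apply: eq_J_pi => x _; rewrite cimZr. Qed.

Lemma cre_ccosint F k : cre (ccosint F k) = J (fun x => cre (F x) * cos (k%:R * x)).
Proof. by apply: eq_J_pi => x _; rewrite creZr. Qed.

Lemma cim_ccosint F k : cim (ccosint F k) = J (fun x => cim (F x) * cos (k%:R * x)).
Proof. by apply: eq_J_pi => x _; rewrite cimZr. Qed.

Lemma cre_fcoef F k : cre (fcoef F k) = sin_coef (re F) k.
Proof.
by rewrite /fcoef creZ; congr (_ * _); apply: eq_J_pi => x _; rewrite creZr.
Qed.

Lemma cim_fcoef F k : cim (fcoef F k) = sin_coef (im F) k.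
Proof.
by rewrite /fcoef cimZ; congr (_ * _); apply: eq_J_pi => x _; rewrite cimZr.
Qed.

Lemma fcoefE F k : cintegrable I F -> fcoef F k = rC (r2 / pi) * csinint F k.
Proof.
move=> [f1 f2]; apply: eq_creim.
  by rewrite cre_fcoef sin_coefE // creZ cre_csinint.
by rewrite cim_fcoef sin_coefE // cimZ cim_csinint.
Qed.

Lemma cre_Vt Q k : cre (Vt Q k) = k%:R * sin_coef (re Q) k.
Proof.
case: k => [|k]; first by rewrite mul0r.
by rewrite -[Vt Q k.+1]/(rC k.+1%:R * fcoef Q k.+1) creZ cre_fcoef.
Qed.

Lemma cim_Vt Q k : cim (Vt Q k) = k%:R * sin_coef (im Q) k.
Proof.
case: k => [|k]; first by rewrite mul0r.
by rewrite -[Vt Q k.+1]/(rC k.+1%:R * fcoef Q k.+1) cimZ cim_fcoef.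
Qed.

Lemma eq_fcoef F G k : (forall x, I x -> F x = G x) -> fcoef F k = fcoef G k.
Proof.
by move=> FG; rewrite /fcoef; congr (_ * _); apply: eq_cint => x /FG ->.
Qed.

(* Limit of the convolution series: [- (2 / pi) int Q (y sin kx)'] with
   [y' = F]. *)
Definition potential_sum Q F k : R[i] := - (rC (2 / pi) *
  (csinint (fun x => Q x * F x) k +
   rC k%:R * ccosint (fun x => Q x * cint 0 x F) k)).

Lemma series_sub (u v : R^nat) : series (fun m => u m - v m) = series u \- series v.
Proof. by apply/funext => n; rewrite !seriesEnat /= sumrB. Qed.

Lemma series_add (u v : R^nat) : series (fun m => u m + v m) = series u \+ series v.
Proof. by apply/funext => n; rewrite !seriesEnat /= big_split. Qed.

Lemma primitive_cL2 F : cL2 I F -> cL2 I (fun x => cint 0 x F).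
Proof.
by move=> /cL2P[f1 f2]; apply/cL2P; split; apply: primitive_L2; exact: in_L2_L1_pi.
Qed.

(** The series is bilinear in [Q] and [F], without conjugation, so it is assembled from four real
    convolution series pairing real and imaginary parts. *)
Lemma potential_series Q F k : cL2 I Q -> cL2 I F -> cint 0 pi F = 0 ->
  cseries_to (fun m => (Vt Q (ndist k m.+1) - Vt Q (k + m.+1)) *
    fcoef (fun x => cint 0 x F) m.+1) (potential_sum Q F k).
Proof.
move=> QL FL Fpi; have /cL2P[q1 q2] := QL; have /cL2P[f1 f2] := FL.
have /cL2P[p1 p2] := primitive_cL2 FL.
have fp1 : prim (re F) pi = 0 by have /(congr1 (@cre R)) := Fpi.
have fp2 : prim (im F) pi = 0 by have /(congr1 (@cim R)) := Fpi.
pose L q f := J (fun x => q x * f x * sin (k%:R * x)) +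
    k%:R * J (fun x => q x * prim f x * cos (k%:R * x)).
have H q f : in_L2 q -> in_L2 f ->
    in_L1 (fun x => q x * f x * sin (k%:R * x)) /\
    in_L1 (fun x => q x * prim f x * cos (k%:R * x)).
  move=> qL fL; split; first by apply: in_L1_sinM; exact: in_L2M_pi.
  by apply: in_L1_cosM; apply: in_L2M_pi => //; apply: primitive_L2; exact: in_L2_L1_pi.
pose v q f m := ((ndist k m.+1)%:R * sin_coef q (ndist k m.+1) -
  (k + m.+1)%:R * sin_coef q (k + m.+1)) * sin_coef (fun x => prim f x) m.+1.
have S q f : in_L2 q -> in_L2 f -> prim f pi = 0 ->
    series (v q f) @ \oo --> - (2 / pi * L q f).
  move=> qL fL fpi; have [h1 h2] := H q f qL fL.
  have := @convolution_series R q f k qL fL fpi; rewrite (_ : J _ = L q f) //.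
  rewrite /L -JZ_pi // -JD_pi //; last exact: in_L1Z_pi.
  by apply: eq_J_pi => x _; ring.
have [a1 a2] := H _ _ q1 f1; have [b1 b2] := H _ _ q2 f2.
have [c1 c2] := H _ _ q1 f2; have [d1 d2] := H _ _ q2 f1.
split.
  rewrite (_ : (fun _ => _) = (fun m => v (re Q) (re F) m - v (im Q) (im F) m)).
    rewrite series_sub (_ : cre _ = - (2 / pi * L (re Q) (re F)) -
       - (2 / pi * L (im Q) (im F))); first by apply: cvgB; exact: S.
    rewrite /potential_sum !(creN, creZ, creD) cre_csinint cre_ccosint.
    transitivity (- (2 / pi * (L (re Q) (re F) - L (im Q) (im F)))); last by ring.
    congr (- (_ * _)).
    rewrite (@eq_J_pi _ _ (fun x => cre (Q x) * cre (F x) * sin (k%:R * x) -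
      cim (Q x) * cim (F x) * sin (k%:R * x))); last first.
      by move=> x _; rewrite creM mulrBl.
    rewrite [X in _ + _ * X](@eq_J_pi _ _ (fun x => cre (Q x) * prim (re F) x * cos (k%:R * x) -
      cim (Q x) * prim (im F) x * cos (k%:R * x))); last first.
      by move=> x _; rewrite creM mulrBl.
    by rewrite !JB_pi // /L; ring.
  apply/funext => m; cbv beta.
  by rewrite creM creD cimD creN cimN !cre_Vt !cim_Vt cre_fcoef cim_fcoef.
rewrite (_ : (fun _ => _) = (fun m => v (re Q) (im F) m + v (im Q) (re F) m)).
  rewrite series_add (_ : cim _ = - (2 / pi * L (re Q) (im F)) +
     - (2 / pi * L (im Q) (re F))); first by apply: cvgD; exact: S.
  rewrite /potential_sum !(cimN, cimZ, cimD) cim_csinint cim_ccosint.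
  rewrite -opprD -mulrDr; congr (- (_ * _)).
  rewrite (@eq_J_pi _ _ (fun x => cre (Q x) * cim (F x) * sin (k%:R * x) +
    cim (Q x) * cre (F x) * sin (k%:R * x))); last first.
    by move=> x _; rewrite cimM mulrDl.
  rewrite [X in _ + _ * X](@eq_J_pi _ _ (fun x => cre (Q x) * prim (im F) x * cos (k%:R * x) +
    cim (Q x) * prim (re F) x * cos (k%:R * x))); last first.
    by move=> x _; rewrite cimM mulrDl.
  by rewrite !JD_pi // /L; ring.
apply/funext => m; cbv beta.
by rewrite cimM creD cimD creN cimN !cre_Vt !cim_Vt cre_fcoef cim_fcoef.
Qed.

Lemma cweak_form u F G (w : R -> R[i]) k : cintegrable I u -> cL2 I F ->
  cintegrable I G -> cint 0 pi F = 0 ->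
  (forall x, I x -> w x = w 0 + cint 0 x u) ->
  ae_eqc I (fun x => F x - G x) w -> (0 < k)%N ->
  - csinint u k = rC (k%:R ^+ 2) * csinint (fun x => cint 0 x F) k -
    rC k%:R * ccosint G k.
Proof.
move=> [u1 u2] /cL2P[f1 f2] [g1 g2] Fpi wE Fw k0.
have fp1 : prim (re F) pi = 0 by have /(congr1 (@cre R)) := Fpi.
have fp2 : prim (im F) pi = 0 by have /(congr1 (@cim R)) := Fpi.
apply: eq_creim.
  rewrite !(creD, creN, creZ) !cre_csinint cre_ccosint.
  apply: (@weak_form R _ _ _ (cre (w 0)) k u1 f1 g1 fp1 _ k0).
  apply: (@filterS _ _ (ae_filter_ringOfSetsType mu) _ _ _ Fw) => x h Ix.
  by have := congr1 (@cre R) (h Ix); rewrite wE // creD creN creD.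
rewrite !(cimD, cimN, cimZ) !cim_csinint cim_ccosint.
apply: (@weak_form R _ _ _ (cim (w 0)) k u2 f2 g2 fp2 _ k0).
apply: (@filterS _ _ (ae_filter_ringOfSetsType mu) _ _ _ Fw) => x h Ix.
by have := congr1 (@cim R) (h Ix); rewrite wE // cimD cimN cimD.
Qed.

Lemma cweak_form_inv u F G : cintegrable I u -> cL2 I F ->
  cintegrable I G -> cint 0 pi F = 0 ->
  (forall k, (0 < k)%N ->
    - csinint u k = rC (k%:R ^+ 2) * csinint (fun x => cint 0 x F) k -
    rC k%:R * ccosint G k) ->
  exists w0, ae_eqc I (fun x => F x - G x) (fun x => w0 + cint 0 x u).
Proof.
move=> [u1 u2] /cL2P[f1 f2] [g1 g2] Fpi h.
have fp1 : prim (re F) pi = 0 by have /(congr1 (@cre R)) := Fpi.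
have fp2 : prim (im F) pi = 0 by have /(congr1 (@cim R)) := Fpi.
have [k k0|a ha] := weak_form_inv u1 f1 g1 fp1.
  have := congr1 (@cre R) (h k k0).
  by rewrite !(creD, creN, creZ) !cre_csinint cre_ccosint.
have [k k0|b hb] := weak_form_inv u2 f2 g2 fp2.
  have := congr1 (@cim R) (h k k0).
  by rewrite !(cimD, cimN, cimZ) !cim_csinint cim_ccosint.
exists (a +i* b)%C.
apply: (@filterS2 _ _ (ae_filter_ringOfSetsType mu) _ _ _ _ ha hb) => x hax hbx Ix.
by apply: eq_creim; rewrite !(creD, creN, cimD, cimN) /= ?hax ?hbx.
Qed.

Lemma csinint_ell Q F u (f : R -> R[i]) C k : cL2 I Q -> cL2 I F ->
  cintegrable I u -> cL2 I f ->
  ae_eqc I f (fun x => - u x - Q x * F x + C * cint 0 x F) ->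
  csinint f k = - csinint u k - csinint (fun x => Q x * F x) k +
    C * csinint (fun x => cint 0 x F) k.
Proof.
move=> QL FL uL fL fE.
have QF := cintegrableM QL FL; have Y := cL2_cintegrable (primitive_cL2 FL).
have uk := cintegrable_sin k uL; have QFk := cintegrable_sin k QF.
have Yk := cintegrable_sin k Y.
have n1 := cintegrableZ (-1) uk; have n2 := cintegrableZ (-1) QFk.
have n3 := cintegrableZ C Yk; have n12 := cintegrableD n1 n2.
transitivity (cint 0 pi (fun x => (-1) * (u x * rC (sin (k%:R * x))) +
  (-1) * (Q x * F x * rC (sin (k%:R * x))) +
  C * (cint 0 x F * rC (sin (k%:R * x))))).
  apply: ae_eq_cint.
  - by apply: cintegrable_sin; exact: cL2_cintegrable.
  - exact: (cintegrableD n12 n3).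
  - apply: (@filterS _ _ (ae_filter_ringOfSetsType mu) _ _ _ fE) => x h Ix.
    by rewrite h //; ring.
by rewrite cintD // cintD // !cintZ // !mulN1r.
Qed.

(** Reconciles the factor $1/\sqrt2$ of [Ld] with the $\sqrt2/\pi$ that multiplies sine integrals in
    [fcoef]. *)
Lemma rC_sqrt2 : rC (r2^-1) * rC (2 / pi) = rC (r2 / pi) :> R[i].
Proof.
rewrite -rCM; congr rC; rewrite mulrA; congr (_ * _).
by rewrite -[X in _ * X]sqrt2_sqr mulKf // sqrt2_neq0.
Qed.

(** The integral of [Q F sin kx] and the term in [C] occur on both sides and cancel; the rest is the
    weak form up to the nonzero factor $\sqrt2/\pi$. The equivalence is read left to right to
    recover regularity and right to left to compute coefficients. *)
Lemma fcoef_ell Q F u (f : R -> R[i]) C k : cL2 I Q -> cL2 I F ->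
  cintegrable I u -> cL2 I f ->
  ae_eqc I f (fun x => - u x - Q x * F x + C * cint 0 x F) ->
  (fcoef f k = rC (k%:R ^+ 2) * fcoef (fun x => cint 0 x F) k +
     rC (r2^-1) * potential_sum Q F k + C * fcoef (fun x => cint 0 x F) k) <->
  (- csinint u k = rC (k%:R ^+ 2) * csinint (fun x => cint 0 x F) k -
    rC k%:R * ccosint (fun x => Q x * cint 0 x F) k).
Proof.
move=> QL FL uL fL fE.
have Y := cL2_cintegrable (primitive_cL2 FL).
rewrite !fcoefE //; last exact: cL2_cintegrable.
rewrite (csinint_ell k QL FL uL fL fE) /potential_sum mulrN [_ * (rC (2 / pi) * _)]mulrA.
rewrite rC_sqrt2.
have : rC (r2 / pi) != 0 :> R[i].
  by apply: rC_neq0; rewrite mulf_neq0 ?sqrt2_neq0 // invr_eq0 pi_neq0.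
move: (rC (r2 / pi)) (csinint u k) (csinint (fun x => Q x * F x) k)
  (csinint (fun x => cint 0 x F) k) (ccosint _ k).
move=> r U QF Yk P r0; split=> h.
  apply: (mulfI r0); rewrite -[LHS](addrK (r * (- QF + C * Yk))).
  rewrite -mulrDr addrA h; ring.
by rewrite h; ring.
Qed.

(** [y(0) = 0] removes the constant from [y], and [y(pi) = 0] gives [F] mean zero. Stating the
    result with [potential_sum] serves both the domain inclusion and the operator formula. *)
Lemma LDir_fcoef Q C (y f : R -> R[i]) : cL2 I Q -> LDir_rel Q C y f ->
  exists F, [/\ cL2 I F, cint 0 pi F = 0, forall x, I x -> y x = cint 0 x F &
   forall k, (0 < k)%N ->
     fcoef f k = rC (k%:R ^+ 2) * fcoef y k +
     rC (r2^-1) * potential_sum Q F k + C * fcoef y k].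
Proof.
move=> QL [F [w [u [FL [yE [uL [wE [Fw [y0 [ypi [fL fE]]]]]]]]]]].
have yE' x : I x -> y x = cint 0 x F by move=> Ix; rewrite yE // y0 add0r.
have Fpi : cint 0 pi F = 0.
  by rewrite -yE' // /Icc /= in_itv /= lexx pi_ge0.
exists F; split => // k k0.
have e := eq_fcoef k yE'; rewrite !e.
have fE' : ae_eqc I f (fun x => - u x - Q x * F x + C * cint 0 x F).
  apply: (@filterS _ _ (ae_filter_ringOfSetsType mu) _ _ _ fE) => x h Ix.
  by rewrite h // yE'.
apply/(fcoef_ell k QL FL uL fL fE').
apply: (cweak_form uL FL _ Fpi wE _ k0).
  by apply: cintegrableM => //; exact: primitive_cL2.
apply: (@filterS _ _ (ae_filter_ringOfSetsType mu) _ _ _ Fw) => x h Ix.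
by rewrite -h // yE'.
Qed.

End ComplexValued.

(** * Domains of the two operators *)

Section Domains.
Variable R : realType.
Implicit Types (x a b : R) (z c s : R[i]) (F G Q : R -> R[i]) (j k m n : nat).
Local Notation mu := (@lebesgue_measure R).
Local Notation I := (Icc 0 (pi : R)).
Local Notation J f := (Rintegral mu I f).
Local Notation in_L1 := (in_L1 mu I).
Local Notation in_L2 := (in_L2 mu I).
Local Notation r2 := (Num.sqrt (2 : R)).
Local Notation re F := (fun x => cre (F x)).
Local Notation im F := (fun x => cim (F x)).
Local Notation prim u x := (Rintegral mu (Icc 0 x) u).
Local Notation csin := (coef mu I (@esin R) pi).
Local Notation ccos := (coef mu I (@ecos R) pi).

Lemma coef_ecos_prim g m : in_L2 g -> prim g pi = 0 ->
  ccos g m.+1 = m.+1%:R * sin_coef (fun x => prim g x) m.+1.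
Proof.
move=> gL gpi; have gL1 := in_L2_L1_pi gL.
have pL := in_L2_L1_pi (primitive_L2 gL1).
by rewrite coef_ecosS // by_parts_cos // sin_coefE //; ring.
Qed.

Lemma coef_ecos0_prim g : prim g pi = 0 -> ccos g 0 = 0.
Proof. by move=> gpi; rewrite coef_ecos0 gpi mulr0. Qed.

(** The weight [t] is 1 for [in_l2] and [k + 1] for [in_l2k]. *)
Lemma csq_summable (u v : R^nat) (z : nat -> R[i]) (t : nat -> R) :
  (forall k, u k = t k * cre (z k)) -> (forall k, v k = t k * cim (z k)) ->
  cvgn (series (fun k => u k ^+ 2)) -> cvgn (series (fun k => v k ^+ 2)) ->
  cvgn (series (fun k => t k ^+ 2 * csq (z k))).
Proof.
move=> uE vE cu cv.
rewrite (_ : (fun _ => _) = (fun k => u k ^+ 2 + v k ^+ 2)).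
  by rewrite series_add; exact: is_cvgD.
by apply/funext => k; rewrite uE vE /csq !exprMn mulrDr.
Qed.

Lemma summable_csq (z : nat -> R[i]) (t : nat -> R) :
  cvgn (series (fun k => t k ^+ 2 * csq (z k))) ->
  cvgn (series (fun k => (t k * cre (z k)) ^+ 2)) /\
  cvgn (series (fun k => (t k * cim (z k)) ^+ 2)).
Proof.
move=> cz.
have t0 k : 0 <= t k ^+ 2 * csq (z k).
  by rewrite mulr_ge0 ?sqr_ge0 // addr_ge0 ?sqr_ge0.
split; apply: (series_le_cvg _ t0 _ cz) => k; rewrite ?sqr_ge0 // exprMn.
  by rewrite ler_wpM2l ?sqr_ge0 // lerDl sqr_ge0.
by rewrite ler_wpM2l ?sqr_ge0 // lerDr sqr_ge0.
Qed.

Lemma in_l2_fcoef F : cL2 I F -> in_l2 (fcoef F).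
Proof.
move=> /cL2P[f1 f2]; rewrite /in_l2 /rsum_finite.
have c1 := @bessel_cvg _ _ R mu I (@measurable_I R) _ pi (pi_gt0 R) (@esin_L2 R) (@esin_orth R) _ f1.
have c2 := @bessel_cvg _ _ R mu I (@measurable_I R) _ pi (pi_gt0 R) (@esin_L2 R) (@esin_orth R) _ f2.
have := csq_summable (z := fun k => fcoef F k.+1) (t := fun=> 1) _ _ c1 c2.
rewrite (_ : (fun k => 1 ^+ 2 * _) = (fun k => csq (fcoef F k.+1))); last first.
  by apply/funext => k; rewrite expr1n mul1r.
by apply=> k; rewrite mul1r ?cre_fcoef ?cim_fcoef.
Qed.

(** [k] times the sine coefficient of the primitive is the cosine coefficient of [F], so this is
    Bessel's inequality for the cosines. *)
Lemma in_l2k_fcoef F : cL2 I F -> cint 0 pi F = 0 ->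
  in_l2k (fcoef (fun x => cint 0 x F)).
Proof.
move=> /cL2P[f1 f2] Fpi; rewrite /in_l2k /rsum_finite.
have fp1 : prim (re F) pi = 0 by have /(congr1 (@cre R)) := Fpi.
have fp2 : prim (im F) pi = 0 by have /(congr1 (@cim R)) := Fpi.
have c1 := @bessel_cvg _ _ R mu I (@measurable_I R) _ pi (pi_gt0 R) (@ecos_L2 R) (@ecos_orth R) _ f1.
have c2 := @bessel_cvg _ _ R mu I (@measurable_I R) _ pi (pi_gt0 R) (@ecos_L2 R) (@ecos_orth R) _ f2.
have shift g : in_L2 g -> prim g pi = 0 ->
    cvgn (series (fun k => ccos g k ^+ 2)) ->
    cvgn (series (fun k => ccos g k.+1 ^+ 2)).
  move=> gL gpi /(@cvg_series_shift _ (fun k => ccos g k ^+ 2)) h.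
  apply/cvg_ex; eexists; apply: h.
  by rewrite coef_ecos0_prim // expr0n.
apply: (csq_summable (z := fun k => fcoef _ k.+1) (t := fun k => k.+1%:R) _ _
  (shift _ f1 fp1 c1) (shift _ f2 fp2 c2)) => k.
  by rewrite coef_ecos_prim // cre_fcoef.
by rewrite coef_ecos_prim // cim_fcoef.
Qed.

Lemma cseries_unique (u : nat -> R[i]) s s' :
  cseries_to u s -> cseries_to u s' -> s = s'.
Proof.
by move=> [h1 h2] [h1' h2']; apply: eq_creim; [exact: cvg_unique h1 h1'|exact: cvg_unique h2 h2'].
Qed.

(** Riesz-Fischer for the cosines builds the derivative from [k] times the sine coefficients of [y].
    Its primitive then has the same sine coefficients as [y], and completeness of the sines
    concludes. *)
Lemma exists_H10 (y : R -> R[i]) : cL2 I y -> in_l2k (fcoef y) ->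
  exists F, [/\ cL2 I F, cint 0 pi F = 0 &
    ae_eqc I (fun x => cint 0 x F) y].
Proof.
move=> /cL2P[y1 y2] hz.
have H f : in_L2 f -> cvgn (series (fun k => (k.+1%:R * sin_coef f k.+1) ^+ 2)) ->
    exists g, [/\ in_L2 g, prim g pi = 0 &
      {ae mu, forall x, I x -> prim g x = f x}].
  (* The value [v 0 = 0] prescribes mean zero for [g], so that its primitive also vanishes at
     [pi]. *)
  move=> fL cf; pose v k := k%:R * sin_coef f k.
  have cv : cvgn (series (fun k => v k ^+ 2)).
    by apply: is_cvg_series_shift => //; rewrite /v mul0r expr0n.
  have [g [gL _ gv]] := @riesz_fischer _ _ R mu I (@measurable_I R) (@mu_I_lty R) _ pi (pi_gt0 R)
    (@ecos_L2 R) (@ecos_orth R) _ cv.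
  have gpi : prim g pi = 0.
    have /eqP := congr1 (@^~ 0%N) gv; rewrite /= coef_ecos0 /v mul0r.
    by rewrite mulf_eq0 invr_eq0 (negbTE (pi_neq0 R)) => /eqP.
  exists g; split => //.
  apply: (@coef_inj _ _ R mu I (@measurable_I R) _ pi (@esin_L2 R) (@esin_eq0 R) _ _ _ fL).
    by apply: primitive_L2; exact: in_L2_L1_pi.
  apply/funext => k; rewrite !coef_esin.
  have /eqP := congr1 (@^~ k.+1) gv; rewrite /= coef_ecos_prim // /v.
  by rewrite (inj_eq (mulfI _)) ?pnatr_eq0 // => /eqP.
have [c1 c2] := summable_csq (z := fun k => fcoef y k.+1) (t := fun k => k.+1%:R) hz.
have [|g1 [g1L g1pi g1y]] := H _ y1.
  by move: c1; congr (cvgn (series _)); apply/funext => k; rewrite cre_fcoef.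
have [|g2 [g2L g2pi g2y]] := H _ y2.
  by move: c2; congr (cvgn (series _)); apply/funext => k; rewrite cim_fcoef.
exists (fun x => g1 x +i* g2 x)%C; split.
- exact/cL2P.
- exact: eq_creim.
- apply: (@filterS2 _ _ (ae_filter_ringOfSetsType mu) _ _ _ _ g1y g2y) => x h1 h2 Ix.
  by apply: eq_creim; [exact: h1|exact: h2].
Qed.

Lemma exists_L2 (h : nat -> R[i]) : in_l2 h ->
  exists f, cL2 I f /\ forall k, (0 < k)%N -> fcoef f k = h k.
Proof.
move=> hh.
have H (v : R^nat) : cvgn (series (fun k => v k ^+ 2)) ->
    exists f, in_L2 f /\ forall k, sin_coef f k.+1 = v k.
  move=> cv.
  have [f [fL _ fv]] := @riesz_fischer _ _ R mu I (@measurable_I R) (@mu_I_lty R) _ pi (pi_gt0 R)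
    (@esin_L2 R) (@esin_orth R) _ cv.
  by exists f; split => // k; rewrite -coef_esin fv.
have [|c1 c2] := summable_csq (z := fun k => h k.+1) (t := fun=> 1).
  by move: hh; congr (cvgn (series _)); apply/funext => k; rewrite expr1n mul1r.
have [f1 [f1L f1h]] := H _ c1; have [f2 [f2L f2h]] := H _ c2.
exists (fun x => f1 x +i* f2 x)%C; split; first exact/cL2P.
case=> // k _; apply: eq_creim.
  by rewrite cre_fcoef f1h mul1r.
by rewrite cim_fcoef f2h mul1r.
Qed.

Lemma ae_eq_fcoef F G k : cL2 I F -> cL2 I G -> ae_eqc I F G ->
  fcoef F k = fcoef G k.
Proof.
move=> /cL2_cintegrable fL /cL2_cintegrable gL FG.
rewrite !fcoefE //; congr (_ * _); apply: ae_eq_cint.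
- exact: cintegrable_sin.
- exact: cintegrable_sin.
- apply: (@filterS _ _ (ae_filter_ringOfSetsType mu) _ _ _ FG) => x h Ix.
  by rewrite h.
Qed.

(** [y] is any representative of its [L^2] class and [y0] the absolutely continuous one; sine
    coefficients do not distinguish them. *)
Lemma in_dom_Ld_LDir Q C (y0 y f : R -> R[i]) : cL2 I Q -> cL2 I y ->
  ae_eqc I y0 y -> LDir_rel Q C y0 f -> in_dom_Ld Q C (fcoef y).
Proof.
move=> QL yL y0y Ly0.
have fL : cL2 I f by case: Ly0 => ? [? [? [? [? [? [? [? [? [? []]]]]]]]]].
have [F [FL Fpi y0E fE]] := LDir_fcoef QL Ly0.
have e k : fcoef y k = fcoef (fun x => cint 0 x F) k.
  rewrite (@ae_eq_fcoef y (fun x => cint 0 x F)) //; first exact: primitive_cL2.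
  apply: (@filterS _ _ (ae_filter_ringOfSetsType mu) _ _ _ y0y) => x h Ix.
  by rewrite -h // y0E.
have {}e : fcoef y = fcoef (fun x => cint 0 x F) by apply/funext.
split; first by rewrite e; exact: in_l2k_fcoef.
exists (fcoef f); split; last exact: in_l2_fcoef.
move=> k k0; exists (potential_sum Q F k); split.
  by rewrite e; exact: potential_series.
by rewrite fE // e (eq_fcoef k y0E).
Qed.

Lemma LDir_in_dom_Ld Q C (y : R -> R[i]) : cL2 I Q -> cL2 I y ->
  in_dom_Ld Q C (fcoef y) ->
  exists y0 f, ae_eqc I y0 y /\ LDir_rel Q C y0 f.
Proof.
move=> QL yL [hz [h [hrel hl2]]].
have [F [FL Fpi Fy]] := exists_H10 yL hz.
have [f [fL fh]] := exists_L2 hl2.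
have YL := primitive_cL2 FL; pose y0 x := cint 0 x F.
have e : fcoef y = fcoef y0.
  apply/funext => k; apply/esym.
  exact: ae_eq_fcoef.
(* The equation [l(y0) = f] solved for the derivative of the quasi-derivative; the product [Q F]
   makes it integrable only. *)
pose u x := - f x - Q x * F x + C * y0 x.
have uL : cintegrable I u.
  apply: cintegrableD; last by apply: cintegrableZ; exact: cL2_cintegrable.
  apply: cintegrableD; apply: cintegrableN; first exact: cL2_cintegrable.
  exact: cintegrableM.
have fE : ae_eqc I f (fun x => - u x - Q x * F x + C * y0 x).
  by apply: aeW => x _; rewrite /u; ring.
have QY : cintegrable I (fun x => Q x * y0 x) by exact: cintegrableM.
(* The row equations of [Ld], read through [fcoef_ell], are the hypothesis of the converse weak
   form, which returns the missing absolute continuity of [F - Q y0]. *)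
have [k k0|w0 hw] := cweak_form_inv uL FL QY Fpi.
  apply/(fcoef_ell k QL FL uL fL fE).
  have [s [hs hk]] := hrel k k0; rewrite fh // hk e.
  by rewrite e in hs; rewrite (cseries_unique hs (potential_series k QL FL Fpi)).
pose w x := w0 + cint 0 x u.
have cint0 G : cint 0 0 G = 0 by apply: eq_creim; exact: primitive_at0.
exists y0, f; split=> //; exists F, w, u; split => //.
split; first by move=> x _; rewrite /y0 cint0 add0r.
split=> //; split; first by move=> x _; rewrite /w cint0 addr0.
by do !split => //; rewrite /y0 ?cint0.
Qed.

(** The sum in [Ld_rel] is existentially quantified; uniqueness of limits identifies it with
    [potential_sum]. *)
Lemma LDir_Ld_fcoef Q C (y f : R -> R[i]) (h : nat -> R[i]) k : cL2 I Q ->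
  LDir_rel Q C y f -> Ld_rel Q C (fcoef y) h -> (0 < k)%N -> fcoef f k = h k.
Proof.
move=> QL Ly hrel k0; have [F [FL Fpi yE ->//]] := LDir_fcoef QL Ly.
have [s [hs ->]] := hrel k k0; congr (_ + rC _ * _ + _).
have e : fcoef y = fcoef (fun x => cint 0 x F).
  by apply/funext => j; exact: eq_fcoef.
rewrite e in hs; exact: (cseries_unique (potential_series k QL FL Fpi) hs).
Qed.

End Domains.

Theorem theorem16 (R : realType) (Q : R -> R[i]) (C : R[i]) :
  (forall x, Q (x + pi) = Q x) ->
  cL2 (Icc 0 pi) Q ->
  cint 0 pi Q = 0 ->
  (* D(L_Dir) = F^{-1}(D(L_d)) *)
  (forall y : R -> R[i], cL2 (Icc 0 pi) y ->
     ((exists y0 f, ae_eqc (Icc 0 pi) y0 y /\ LDir_rel Q C y0 f) <->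
      in_dom_Ld Q C (fcoef y))) /\
  (* L_Dir = F^{-1} o L_d o F *)
  (forall (y f : R -> R[i]) (h : nat -> R[i]),
     LDir_rel Q C y f -> Ld_rel Q C (fcoef y) h ->
     forall k : nat, (1 <= k)%N -> fcoef f k = h k).
Proof.
move=> _ QL _; split=> [y yL|y f h Ly hrel k k0].
  split=> [[y0 [f [y0y Ly0]]]|]; first exact: in_dom_Ld_LDir y0y Ly0.
  exact: LDir_in_dom_Ld.
exact: LDir_Ld_fcoef Ly hrel k0.
Qed.
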